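(* Let $V\in\mathcal S_{P_1}(\mathcal K,\gamma)$, and let $P_V,Z_V,U_V$ and $W_V:=U_V^\dagger V$ be the operators associated with $V$ as defined in the context. Then $$V=U_VW_V$$ with $U_V\in\mathcal S_{\mathrm{HS}}(\mathcal K,\gamma)$ and $W_V\in\mathcal S_{\mathrm{diag}}(\mathcal K,\gamma)$, and these operators have the properties $$\operatorname{ind}U_V=0,\quad Z_{U_V}=Z_V,\quad P_{U_V}=P_V;\qquad \operatorname{ind}W_V=\operatorname{ind}V,\quad Z_{W_V}=0,\quad P_{W_V}=P_1.$$ In particular, if $V\in\mathcal S_{P_1}(\mathcal K,\gamma)$ has $\operatorname{ind}V=0$, then, with respect to $\mathcal K=\mathcal K_1\oplus\mathcal K_2$, $$U_V=\begin{pmatrix}|V_{11}^*|& V_{12}v_{22}^*\\ V_{21}v_{11}^*&|V_{22}^*|\end{pmatrix},\qquad W_V=\begin{pmatrix}v_{11}&0\\0&v_{22}\end{pmatrix},$$ where $v_{11}:=V_{11}|V_{11}|^{-1}$ and $v_{22}=\overline{v_{11}}$ are the unitary parts of $V_{11}$ and $V_{22}$; whereas if $V\in\mathcal S_{\mathrm{diag}}(\mathcal K,\gamma)$, then $U_V=\mathbf 1$ and $W_V=V$.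
   Context: Setting. $\mathcal K$ is a separable infinite-dimensional complex Hilbert space with inner product $\langle\cdot,\cdot\rangle$ (antilinear in the first argument), equipped with a conjugation (antiunitary involution) $f\mapsto f^*$. $P_1$ is an orthogonal projection on $\mathcal K$ such that $P_2:=\mathbf 1-P_1$ satisfies $P_2f=(P_1(f^* ))^*$ for all $f$. Put $C:=P_1-P_2$, $\gamma(f,g):=\langle f,Cg\rangle$, $\mathcal K_n:=P_n(\mathcal K)$. For $A\in\mathfrak B(\mathcal K)$ write $A_{mn}:=P_mAP_n$ (viewed as an operator $\mathcal K_n\to\mathcal K_m$; $A_{mn}^*$ means $(A_{mn})^*$), $A^\dagger:=CA^*C$, $\overline A f:=(A(f^* ))^*$; the same notation is used for operators between $\mathcal K_1$ and $\mathcal K_2$ (extended by $0$), so $Z^\dagger=-Z^*$ for $Z:\mathcal K_1\to\mathcal K_2$. $|T|:=(T^*T)^{1/2}$. Semigroups: $\mathcal S(\mathcal K,\gamma):=\{V\in\mathfrak B(\mathcal K):\overline V=V,\ V^\dagger V=\mathbf 1\}$; $\mathcal S_{P_1}(\mathcal K,\gamma):=\{V\in\mathcal S(\mathcal K,\gamma): V_{12}\text{ Hilbert--Schmidt}\}$; $\mathcal S_{\mathrm{diag}}(\mathcal K,\gamma):=\{V\in\mathcal S(\mathcal K,\gamma):[P_1,V]=0\}$; $\mathcal S_{\mathrm{HS}}(\mathcal K,\gamma):=\{V\in\mathcal S(\mathcal K,\gamma): V-\mathbf 1\text{ Hilbert--Schmidt}\}$. $\operatorname{ind}V=-\dim\ker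 V^\dagger$ is the Fredholm index. The operators associated with $V\in\mathcal S_{P_1}(\mathcal K,\gamma)$. Let $E$ be the orthogonal projection onto $\ker V^\dagger$ and $A:=ECE$, which is self-adjoint and boundedly invertible on $\ker V^\dagger$. Write $A=A_+-A_-$ with $A_\pm\ge0$, $A_+A_-=0$, let $A_+^{-1}$ be the inverse of $A_+$ on $\operatorname{ran}A_+$ and $0$ on $(\operatorname{ran}A_+)^\perp$, and put $$P_{V+}:=A_+^{-1}C,\qquad P_V:=VP_1V^\dagger+P_{V+},\qquad Z_V:=(P_V)_{21}\bigl((P_V)_{11}\bigr)^{-1}:\mathcal K_1\to\mathcal K_2.$$ Here $(P_V)_{11}$ is boundedly invertible on $\mathcal K_1$, and $Z_V$ is Hilbert--Schmidt with $\|Z_V\|<1$ and $Z_V=\overline{Z_V^*}$. Finally, with $Z=Z_V$, $$U_V:=(P_1+Z)(P_1+Z^\dagger Z)^{-1/2}+(P_2-Z^\dagger)(P_2+ZZ^\dagger)^{-1/2},\qquad W_V:=U_V^\dagger V,$$ where $P_1+Z^\dagger Z$ and $P_2+ZZ^\dagger$ are regarded as positive invertible operators on $\mathcal K_1$ and $\mathcal K_2$ respectively. *)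

(* Defs.v *)
From HB Require Import structures.
From mathcomp Require Import all_boot all_order all_algebra.
From mathcomp Require Import sesquilinear.
From mathcomp.real_closed Require Import complex.
From mathcomp Require Import all_classical all_reals all_analysis.

Set Implicit Arguments.
Unset Strict Implicit.
Unset Printing Implicit Defensive.

Import Order.TTheory GRing.Theory Num.Theory.
Import numFieldNormedType.Exports.

Local Open Scope classical_set_scope.
Local Open Scope ring_scope.

Section Operators.
Context (R : realType) (K : completeNormedModType R[i]).
Context (dot : {dot K for Num.conj}).
Implicit Types (A B P S T U V Z : K -> K) (M : set K) (f g : K).

(* Library forms are linear in the first argument; this inner product is
   antilinear in the first argument. *)
Definition inner f g : R[i] := dot g f.

Definition bounded_op A : Prop :=
  linear A /\ exists m : R[i], forall f, `|A f| <= m * `|f|.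

(* The operators [adj], [sqrt_op], [pos_part], [proj_on] and [inv_on] below are
   given by their characteristic properties; each such property has at most one
   solution (for [inv_on]: when [M] is a closed subspace), and [xget] returns
   the zero map if there is none. *)
Definition adj A : K -> K :=
  xget (cst 0)
    [set B | bounded_op B /\ forall f g, inner (B f) g = inner f (A g)].

Definition self_adjoint A : Prop :=
  bounded_op A /\ forall f g, inner (A f) g = inner f (A g).

Definition positive_op A : Prop := bounded_op A /\ forall f, 0 <= inner f (A f).

Definition sqrt_op A : K -> K :=
  xget (cst 0) [set S | positive_op S /\ S \o S = A].

Definition abs_op A : K -> K := sqrt_op (adj A \o A).

Definition pos_part A : K -> K :=
  xget (cst 0) [set S | positive_op S /\
    exists T, [/\ positive_op T, A = S \- T & S \o T = cst 0]].

Definition orth_projection P : Prop := self_adjoint P /\ P \o P = P.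

Definition proj_on M : K -> K :=
  xget (cst 0) [set P | orth_projection P /\ range P = M].

Definition orth M : set K := [set g | forall f, M f -> inner f g = 0].

(* The inverse of the restriction of [T] to the subspace [M], extended by 0. *)
Definition inv_on M T : K -> K :=
  xget (cst 0) [set S | [/\ bounded_op S,
    forall f, M f -> [/\ M (S f), S (T f) = f & T (S f) = f] &
    forall g, orth M g -> S g = 0]].

Definition ker A : set K := [set f | A f = 0].

Definition lin_indep (n : nat) (e : 'I_n -> K) : Prop :=
  forall c : 'I_n -> R[i], \sum_(i < n) c i *: e i = 0 -> forall i, c i = 0.

Definition dim_set M : \bar R :=
  ereal_sup [set x | exists (n : nat) (e : 'I_n -> K),
    [/\ forall i, M (e i), lin_indep e & x = n%:R%:E]].

Definition orthonormal_basis (e : nat -> K) : Prop :=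
  (forall i j, inner (e i) (e j) = (i == j)%:R) /\
  (forall f, (forall i, inner (e i) f = 0) -> f = 0).

(* Orthonormal bases are indexed by [nat]: the space is separable and
   infinite-dimensional. *)
Definition hilbert_schmidt A : Prop :=
  bounded_op A /\ exists e : nat -> K, orthonormal_basis e /\
    (\sum_(0 <= n <oo) (complex.Re (`|A (e n)| ^+ 2))%:E < +oo)%E.

Definition separable_space : Prop := exists S : set K, countable S /\ dense S.

Definition conjugation (star : K -> K) : Prop :=
  [/\ forall (a : R[i]) f g, star (a *: f + g) = Num.conj a *: star f + star g,
      involutive star &
      forall f g, inner (star f) (star g) = Num.conj (inner f g)].

Definition bar (star A : K -> K) : K -> K := star \o A \o star.

Section Splitting.
Variables (star P1 : K -> K).

Definition P2 : K -> K := idfun \- P1.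
Definition Cop : K -> K := P1 \- P2.

(* Operators between [range P1] and [range P2] are extended by 0 to [K]. *)
Definition b11 A : K -> K := P1 \o A \o P1.
Definition b12 A : K -> K := P1 \o A \o P2.
Definition b21 A : K -> K := P2 \o A \o P1.
Definition b22 A : K -> K := P2 \o A \o P2.

Definition block_op A11 A12 A21 A22 : K -> K :=
  (b11 A11 \+ b12 A12) \+ (b21 A21 \+ b22 A22).

Definition dag A : K -> K := Cop \o adj A \o Cop.

Definition S_gamma V : Prop :=
  [/\ bounded_op V, bar star V = V & dag V \o V = idfun].

Definition S_P1 V : Prop := S_gamma V /\ hilbert_schmidt (b12 V).

Definition S_diag V : Prop := S_gamma V /\ P1 \o V = V \o P1.

Definition S_HS V : Prop := S_gamma V /\ hilbert_schmidt (V \- idfun).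

Definition ind V : \bar R := (- dim_set (ker (dag V)))%E.

Definition PVplus V : K -> K :=
  let E := proj_on (ker (dag V)) in
  let Aplus := pos_part (E \o Cop \o E) in
  inv_on (range Aplus) Aplus \o Cop.

Definition PV V : K -> K := (V \o P1 \o dag V) \+ PVplus V.

Definition ZV V : K -> K := b21 (PV V) \o inv_on (range P1) (b11 (PV V)).

Definition UZ Z : K -> K :=
  ((P1 \+ Z) \o inv_on (range P1) (sqrt_op (P1 \+ (dag Z \o Z)))) \+
  ((P2 \- dag Z) \o inv_on (range P2) (sqrt_op (P2 \+ (Z \o dag Z)))).

Definition UV V : K -> K := UZ (ZV V).

Definition WV V : K -> K := dag (UV V) \o V.

(* The factors [T |T|^-1] of [V11] and [V22], on [range P1] and [range P2]. *)
Definition v11 V : K -> K := b11 V \o inv_on (range P1) (abs_op (b11 V)).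
Definition v22 V : K -> K := b22 V \o inv_on (range P2) (abs_op (b22 V)).

Definition unitary_on P T : Prop :=
  [/\ P \o T \o P = T, adj T \o T = P & T \o adj T = P].

End Splitting.
End Operators.

(* Main.v *)
(* Put C = P1 - P2 and A^d = C A^* C. For V in the semigroup, p = P_V is an idempotent
   with p C >= 0, bar p = 1 - p and p V = V P1. For every such p the self-adjoint
   operator X = p C + P2 satisfies X (C X C) = (C X C) X = M with
   M = P1 p P1 + P2 (1 - p) P2 >= 1, and U = X M^(-1/2) is positive with
   U U^d = U^d U = 1 and U P1 U^d = p. Since P1 + Z = X M^(-1) P1 for
   Z = p21 p11^(-1), this U is the operator U_V. Then p V = V P1 says that W = U^d V
   commutes with P1. When ind V = 0 the operator W is unitary, so the diagonal blocks of
   V = U W are polar decompositions with positive parts the blocks of U.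

   Hilbert-Schmidt: U - 1 = (U + 1)^(-1) U (U - U^d) is a multiple of [p, C]. The
   operators whose commutator with C is Hilbert-Schmidt are closed under products,
   adjoints and inverses, and contain the ingredients of p: on ker V^d the absolute
   value of A = E C E differs from E by a Hilbert-Schmidt operator, because
   A^2 - E = E C [E, C] E. *)
Require Import Defs.
From HB Require Import structures.
From mathcomp Require Import all_boot all_order all_algebra.
From mathcomp Require Import sesquilinear ring lra.
From mathcomp.real_closed Require Import complex.
From mathcomp Require Import all_classical all_reals all_analysis.

Set Implicit Arguments.
Unset Strict Implicit.
Unset Printing Implicit Defensive.

Import Order.TTheory GRing.Theory Num.Theory.
Import numFieldNormedType.Exports.

Local Open Scope classical_set_scope.
Local Open Scope ring_scope.

Local Notation "x %:C" := (real_complex _ x) : ring_scope.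

(** The objects in the definitions are functions selected by a characteristic property, so nothing
    can be computed from them directly. The argument runs in the ring of bounded operators, where
    each object gets an explicit formula, and uniqueness of the characteristic property identifies
    the formula with the selected function. Functional calculus is reduced to two tools: solving
    [T h = f] for [T >= 1], and positive square roots that commute with everything commuting with
    the given operator. The obstacle is that [A = E C E] is invertible only on the range of [E].
    Adding [1 - E] to its square gives an operator invertible on the whole space, and the root of
    that operator yields both spectral parts of [A]. The construction of [U] sees [V] only through
    the idempotent [p]; it is applied to [p = P_V] in general and to [p = P] for diagonal [V]. *)

Lemma le0_of_harmonic (R : realType) (x c : R) :
  (forall n : nat, x <= c * n.+1%:R^-1) -> x <= 0.
Proof.
move=> le_x; rewrite leNgt; apply/negP => x_gt0.
have c_gt0 : 0 < c by have := le_x 0%N; rewrite invr1 mulr1; apply: lt_le_trans.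
have := le_x (Num.bound (c / x)).
rewrite leNgt => /negP; apply.
rewrite ltr_pdivrMr ?ltr0n// -ltr_pdivrMl// mulrC.
apply: lt_trans (archi_boundP (divr_ge0 (ltW c_gt0) (ltW x_gt0))) _.
by rewrite ltr_nat.
Qed.

Lemma discriminant_le (R : realFieldType) (a b c : R) : 0 <= a ->
  (forall t, 0 <= a * t ^+ 2 + 2 * b * t + c) -> b ^+ 2 <= a * c.
Proof.
rewrite le0r => /orP[/eqP->|a_gt0] ge0.
  have [->|b0] := eqVneq b 0; first by rewrite expr0n/= mul0r.
  (* For [a = 0] the polynomial is affine, and at this point its value is -1. *)
  have := ge0 (- (c + 1) / (2 * b)); rewrite mul0r add0r.
  have -> : 2 * b * (- (c + 1) / (2 * b)) = - (c + 1) by field.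
  lra.
have := ge0 (- (b / a)).
have -> : a * (- (b / a)) ^+ 2 + 2 * b * - (b / a) + c = (a * c - b ^+ 2) / a.
  by field; rewrite gt_eqF.
by rewrite pmulr_lge0 ?invr_gt0// subr_ge0.
Qed.

(** * The real inner product *)

Section RealInnerProduct.
Context (R : realType) (K : completeNormedModType R[i]).
Context (dot : {dot K for Num.conj}).
Context (norm_inner : forall f : K, `|f| ^+ 2 = inner dot f f).
Implicit Types (f g h : K) (c : R).

Definition rnorm f : R := complex.Re `|f|.
(** The real part determines the inner product, since a factor [i] in one argument recovers the
    imaginary part. Estimates then stay in an ordered field, within reach of [ring] and [lra]. *)
Definition rip f g : R := complex.Re (inner dot f g).

Lemma rnormE f : `|f| = (rnorm f)%:C.
Proof. by rewrite /rnorm RRe_real// ger0_real. Qed.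

Lemma rnorm_ge0 f : 0 <= rnorm f.
Proof. by rewrite -ler0c -rnormE. Qed.

Lemma rnorm_sqr f : rnorm f ^+ 2 = rip f f.
Proof. by rewrite /rip -norm_inner rnormE -rmorphXn. Qed.

Lemma rnorm_eq0 f : rnorm f = 0 -> f = 0.
Proof. by move=> f0; apply/normr0_eq0; rewrite rnormE f0. Qed.

Lemma rnorm0 : rnorm 0 = 0.
Proof. by rewrite /rnorm normr0. Qed.

Lemma rnormN f : rnorm (- f) = rnorm f.
Proof. by rewrite /rnorm normrN. Qed.

Lemma rnormB f g : rnorm (f - g) = rnorm (g - f).
Proof. by rewrite -rnormN opprB. Qed.

Lemma rnormD f g : rnorm (f + g) <= rnorm f + rnorm g.
Proof. by rewrite -lecR rmorphD/= -!rnormE ler_normD. Qed.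

Lemma rnormZ c f : rnorm (c%:C *: f) = `|c| * rnorm f.
Proof.
rewrite /rnorm normrZ [`|f|]rnormE normc_def/= expr0n addr0 sqrtr_sqr.
by rewrite mul0r subr0.
Qed.

Lemma innerC f g : inner dot g f = Num.conj (inner dot f g).
Proof. by rewrite /inner hermC mul1r. Qed.

Lemma innerDr f g h : inner dot f (g + h) = inner dot f g + inner dot f h.
Proof. by rewrite /inner linearDl. Qed.

Lemma innerZr (a : R[i]) f g : inner dot f (a *: g) = a * inner dot f g.
Proof. by rewrite /inner linearZl_LR. Qed.

Lemma innerDl f g h : inner dot (f + g) h = inner dot f h + inner dot g h.
Proof. by rewrite (innerC h) innerDr rmorphD (innerC h f) (innerC h g). Qed.

Lemma innerZl (a : R[i]) f g : inner dot (a *: f) g = Num.conj a * inner dot f g.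
Proof. by rewrite (innerC g) innerZr rmorphM (innerC g f). Qed.

Lemma ReconjC (a : R[i]) : complex.Re (Num.conj a) = complex.Re a.
Proof. by case: a. Qed.

Lemma ripC f g : rip f g = rip g f.
Proof. by rewrite /rip innerC ReconjC. Qed.

Lemma ripDr f g h : rip f (g + h) = rip f g + rip f h.
Proof. by rewrite /rip innerDr raddfD. Qed.

Lemma ripDl f g h : rip (f + g) h = rip f h + rip g h.
Proof. by rewrite /rip innerDl raddfD. Qed.

Lemma ripNr f g : rip f (- g) = - rip f g.
Proof. by rewrite -scaleN1r /rip innerZr mulN1r raddfN. Qed.

Lemma ripNl f g : rip (- f) g = - rip f g.
Proof. by rewrite ripC ripNr ripC. Qed.

Lemma ripZr c f g : rip f (c%:C *: g) = c * rip f g.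
Proof. by rewrite /rip innerZr; case: (inner _ _ _) => a b /=; rewrite mul0r subr0. Qed.

Lemma ripZl c f g : rip (c%:C *: f) g = c * rip f g.
Proof. by rewrite ripC ripZr ripC. Qed.

Lemma rip_i f g : rip f ('i%C *: g) = - complex.Im (inner dot f g).
Proof. by rewrite /rip innerZr mulrC ReiNIm. Qed.

Lemma rip0r f : rip f 0 = 0.
Proof. by rewrite -(scale0r 0) -(rmorph0 (real_complex R)) ripZr mul0r. Qed.

Definition ripE := (ripDl, ripDr, ripNl, ripNr, ripZl, ripZr).

Lemma rip_inj f g : (forall h, rip f h = rip g h) -> f = g.
Proof.
move=> fg; apply/subr0_eq/rnorm_eq0/eqP; rewrite -sqrf_eq0 rnorm_sqr.
by rewrite ripDl ripNl fg subrr.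
Qed.

Lemma rip_normr f g : rip f g <= rnorm f * rnorm g.
Proof.
have [le0|gt0] := leP (rip f g) 0.
  by apply: le_trans le0 _; rewrite mulr_ge0 ?rnorm_ge0.
rewrite -(@ler_pXn2r _ 2) ?nnegrE ?mulr_ge0 ?rnorm_ge0//; last exact: ltW.
rewrite exprMn !rnorm_sqr; apply: discriminant_le => [|t].
  by rewrite -rnorm_sqr sqr_ge0.
have := sqr_ge0 (rnorm (t%:C *: f + g)); rewrite rnorm_sqr !ripE (ripC g f).
by congr (0 <= _); ring.
Qed.

Lemma ler_rip f g : `|rip f g| <= rnorm f * rnorm g.
Proof. by rewrite ler_norml rip_normr lerNl -ripNl -(rnormN f) rip_normr. Qed.

(* The rate [e] bounds both the Cauchy defect and the distance to the limit. *)
Lemma cauchy_rate_limit (u : nat -> K) (e : nat -> R) :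
  e @ \oo --> (0 : R) ->
  (forall m n, (m <= n)%N -> rnorm (u n - u m) <= e m) ->
  exists2 l, u @ \oo --> l & forall n, rnorm (l - u n) <= e n.
Proof.
move=> /cvgr0Pnorm_lt e0 ue.
have : cauchy (u @ \oo).
  apply: cauchy_exP => eps eps_gt0.
  have eps_re : eps = (complex.Re eps)%:C by rewrite RRe_real// gtr0_real.
  have re_gt0 : 0 < complex.Re eps by rewrite -ltcR -eps_re.
  have [N _ eN] := e0 _ re_gt0.
  exists (u N); exists N => // n /= Nn.
  rewrite -ball_normE/= eps_re rnormE ltcR rnormB.
  apply: le_lt_trans (ue _ _ Nn) _; apply: le_lt_trans (ler_norm _) _.
  exact: (eN N (leqnn N)).
move=> /cauchy_cvg; set l := lim _ => ul; exists l => // n.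
move/cvgrPdist_lt: ul => ul.
apply/ler_addgt0Pl => eps eps_gt0.
have epsC : 0 < eps%:C by rewrite -(ltcR 0) in eps_gt0.
have [M _ uM] := ul _ epsC.
have := uM (maxn M n) (leq_maxl _ _).
rewrite /= rnormE ltcR => lu; rewrite -(subrKA (u (maxn M n))).
apply: le_trans (rnormD _ _) (lerD (ltW lu) _).
exact/ue/leq_maxr.
Qed.

(** The solution is the minimizer of [J f = ip f (T f) - 2 phi f], in the manner of Lax and Milgram.
    The case [T = id] is Riesz representation and gives adjoints; a functional [phi = ip f] gives
    surjectivity of [T], hence inverses. *)
Lemma real_additive_riesz (T : K -> K) (phi : K -> R) (m c : R) :
  {morph T : f g / f + g} -> (forall a f, T (a%:C *: f) = a%:C *: T f) ->
  (forall f g, rip (T f) g = rip f (T g)) ->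
  (forall f, rnorm f ^+ 2 <= rip f (T f)) ->
  (forall f, rnorm (T f) <= m * rnorm f) ->
  {morph phi : f g / f + g} -> (forall a f, phi (a%:C *: f) = a * phi f) ->
  (forall f, phi f <= c * rnorm f) ->
  exists h, forall g, rip (T h) g = phi g.
Proof.
move=> TD TZ Tsym Tge1 Tm phiD phiZ phic.
pose q f := rip f (T f); pose J f := q f - 2 * phi f.
have q_ge0 f : 0 <= q f by apply: le_trans (Tge1 f); rewrite sqr_ge0.
have qDZ f g t : q (f + t%:C *: g) = q f + 2 * t * rip (T f) g + t ^+ 2 * q g.
  rewrite /q TD TZ !ripE -(Tsym f g) (ripC g (T f)); ring.
have J_lb f : - c ^+ 2 <= J f.
  have := Tge1 f; have := phic f; rewrite /J -/(q f).
  have := sqr_ge0 (rnorm f - c); lra.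
pose S := [set J f | f in [set: K]].
have infS : has_inf S.
  by split; [exists (J 0), 0|exists (- c ^+ 2) => _ [f _ <-]].
pose e (n : nat) : R := n.+1%:R^-1.
have e_gt0 n : 0 < e n by rewrite invr_gt0 ltr0n.
have J_ge f : inf S <= J f by apply: ge_inf; [exact: infS.2|exists f].
(* The slack is fitted to the midpoint inequality: [q (u n - u k) / 4] is at most the mean of the
   slacks of [u n] and [u k], so the distance is at most [e k]. *)
have /choice[u Ju] (n : nat) : exists f, J f <= inf S + e n ^+ 2 / 4.
  have : 0 < e n ^+ 2 / 4 by rewrite divr_gt0 ?exprn_gt0.
  move=> /inf_adherent/(_ infS)[_ [f _ <-] /ltW ?]; by exists f.
(* parallelogram law for the form [q] *)
have u_cauchy k n : (k <= n)%N -> rnorm (u n - u k) <= e k.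
  move=> kn; rewrite -(@ler_pXn2r _ 2) ?nnegrE ?rnorm_ge0 ?(ltW (e_gt0 _))//.
  have en : e n <= e k by rewrite lef_pV2 ?posrE ?ltr0n// ler_nat.
  have en2 : e n ^+ 2 <= e k ^+ 2.
    by rewrite ler_pXn2r ?nnegrE ?(ltW (e_gt0 _)).
  apply: le_trans (Tge1 _) _; rewrite -/(q _).
  have dE : u n - u k = u n + (-1)%:C *: u k by rewrite rmorphN1 scaleN1r.
  have := J_ge (u k + (2^-1)%:C *: (u n - u k)); move: (Ju n) (Ju k).
  rewrite /J phiD phiZ qDZ dE phiD phiZ qDZ ripDr ripZr.
  rewrite (ripC (T (u k)) (u k)) -/(q (u k)) (Tsym (u n)) (ripC (u n)).
  lra.
have e0 : e @ \oo --> (0 : R) by exact: cvg_harmonic.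
have [h _ hu] := cauchy_rate_limit e0 u_cauchy.
exists h => g; apply/eqP; rewrite -subr_eq0 -sqrf_eq0 eq_le sqr_ge0 andbT.
have Tm' f : rnorm (T f) <= `|m| * rnorm f.
  by apply: le_trans (Tm f) _; rewrite ler_wpM2r ?rnorm_ge0 ?ler_norm.
pose D n := rip (T (u n)) g - phi g.
(* Along every line through [u n] the functional drops by at most the slack. The resulting quadratic
   in [t] is nonnegative, and its discriminant bounds the residual. *)
have D_small n : D n ^+ 2 <= q g * (e n ^+ 2 / 4).
  apply: discriminant_le => // t.
  have := J_ge (u n + t%:C *: g); have := Ju n.
  rewrite /J phiD phiZ qDZ /D; lra.
have D_near n : `|rip (T h) g - phi g - D n| <= `|m| * rnorm g * e n.
  rewrite /D opprB addrA addrNK -ripNl -ripDl.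
  have -> : T h - T (u n) = T (h - u n).
    by rewrite TD -scaleN1r -[in RHS]scaleN1r -(rmorphN1 (real_complex R)) TZ.
  apply: le_trans (ler_rip _ _) _; rewrite mulrAC ler_wpM2r ?rnorm_ge0//.
  by apply: le_trans (Tm' _) _; rewrite ler_wpM2l.
apply: (@le0_of_harmonic _ _ (q g + 2 * (`|m| * rnorm g) ^+ 2)) => n.
have en1 : e n <= 1 by rewrite invf_le1 ?ltr0n// ler1n.
move: (D_small n) (D_near n) (q_ge0 g) (e_gt0 n).
rewrite -/(e n) -[in X in _ -> X -> _](@ler_pXn2r _ 2) ?nnegrE ?mulr_ge0 ?rnorm_ge0 ?(ltW (e_gt0 _))//.
rewrite real_normK ?num_real// exprMn.
set y := rip (T h) g - phi g; set x := D n; set M := (`|m| * rnorm g) ^+ 2.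
have M0 : 0 <= M by rewrite sqr_ge0.
move=> h1 h2 h3 h4.
have : y ^+ 2 <= 2 * x ^+ 2 + 2 * (y - x) ^+ 2.
  rewrite -subr_ge0; have := sqr_ge0 (2 * x - y); congr (0 <= _); ring.
have : e n ^+ 2 <= e n by rewrite expr2 ler_piMr ?(ltW (e_gt0 _)).
nra.
Qed.

End RealInnerProduct.

(** * The ring of bounded operators *)

Section BoundedOperators.
Context (R : realType) (K : completeNormedModType R[i]).

Record bop := Bop { bop_fun :> K -> K; bopP : bounded_op bop_fun }.

Lemma bop_inj (A B : bop) : A =1 B -> A = B.
Proof.
case: A B => [A hA] [B hB] /= /funext AB; case: _ / AB in hB *.
by congr Bop; exact: Prop_irrelevance.
Qed.

HB.instance Definition _ (A : bop) :=
  GRing.isLinear.Build R[i] K K *:%R (bop_fun A) (bopP A).1.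

(** The constant [m] of [bounded_op] is a complex number. Since [m * |f|] dominates a norm, it
    equals its own absolute value, so the real number [|m|] can take the place of [m]. *)
Lemma bounded_opP (A : K -> K) : linear A ->
  bounded_op A <-> exists2 c : R, 0 <= c & forall f, rnorm (A f) <= c * rnorm f.
Proof.
move=> linA; split=> [[_ [m Am]]|[c c0 Ac]]; last first.
  by split=> //; exists c%:C => f; rewrite !rnormE -rmorphM lecR.
exists (complex.Re `|m|) => [|f]; first by rewrite -ler0c RRe_real ?ger0_real.
have mf : m * `|f| = `|m| * `|f|.
  by rewrite -[in RHS](normr_id f) -normrM ger0_norm// (le_trans _ (Am f)).
have := Am f; rewrite mf -[`|m|]RRe_real ?ger0_real// !rnormE.
by rewrite -(rmorphM (real_complex R)) lecR.
Qed.

Definition op_le (A : bop) (c : R) := forall f, rnorm (A f) <= c * rnorm f.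

Lemma bop_bound (A : bop) : exists2 c, 0 <= c & op_le A c.
Proof. by apply/bounded_opP; [exact: (bopP A).1|exact: bopP]. Qed.

Lemma bounded_zero : bounded_op (fun _ : K => 0 : K).
Proof.
apply/bounded_opP; first by move=> a f g; rewrite scaler0 addr0.
by exists 0 => // f; rewrite mul0r /rnorm normr0.
Qed.

Lemma bounded_id : bounded_op (fun f : K => f).
Proof. by apply/bounded_opP => //; exists 1 => // f; rewrite mul1r. Qed.

Lemma bounded_add (A B : bop) : bounded_op (fun f => A f + B f).
Proof.
apply/bounded_opP; first by move=> a f g; rewrite !linearP scalerDr addrACA.
have [a a0 Aa] := bop_bound A; have [b b0 Bb] := bop_bound B.
exists (a + b) => [|f]; first exact: addr_ge0.
by apply: le_trans (rnormD _ _) _; rewrite mulrDl lerD.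
Qed.

Lemma bounded_opp (A : bop) : bounded_op (fun f => - A f).
Proof.
apply/bounded_opP; first by move=> a f g; rewrite linearP opprD scalerN.
by have [a a0 Aa] := bop_bound A; exists a => // f; rewrite rnormN.
Qed.

Lemma bounded_comp (A B : bop) : bounded_op (fun f => A (B f)).
Proof.
apply/bounded_opP; first by move=> a f g; rewrite !linearP.
have [a a0 Aa] := bop_bound A; have [b b0 Bb] := bop_bound B.
exists (a * b) => [|f]; first exact: mulr_ge0.
by apply: le_trans (Aa _) _; rewrite -mulrA ler_wpM2l.
Qed.

Lemma bounded_scale (c : R) : bounded_op (fun f : K => c%:C *: f).
Proof.
apply/bounded_opP; first by move=> a f g; rewrite scalerDr !scalerA mulrC.
by exists `|c| => // f; rewrite rnormZ.
Qed.

HB.instance Definition _ := gen_eqMixin bop.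
HB.instance Definition _ := gen_choiceMixin bop.

Definition bop_zero := Bop bounded_zero.
Definition bop_one := Bop bounded_id.
Definition bop_add A B := Bop (bounded_add A B).
Definition bop_opp A := Bop (bounded_opp A).
Definition bop_mul A B := Bop (bounded_comp A B).

Lemma bop_addA : associative bop_add.
Proof. by move=> A B C; apply: bop_inj => f; exact: addrA. Qed.
Lemma bop_addC : commutative bop_add.
Proof. by move=> A B; apply: bop_inj => f; exact: addrC. Qed.
Lemma bop_add0 : left_id bop_zero bop_add.
Proof. by move=> A; apply: bop_inj => f; exact: add0r. Qed.
Lemma bop_addN : left_inverse bop_zero bop_opp bop_add.
Proof. by move=> A; apply: bop_inj => f; exact: addNr. Qed.
HB.instance Definition _ :=
  GRing.isZmodule.Build bop bop_addA bop_addC bop_add0 bop_addN.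

Lemma bop_mulA : associative bop_mul.
Proof. by move=> A B C; apply: bop_inj. Qed.
Lemma bop_mul1 : left_id bop_one bop_mul.
Proof. by move=> A; apply: bop_inj. Qed.
Lemma bop_mulr1 : right_id bop_one bop_mul.
Proof. by move=> A; apply: bop_inj. Qed.
Lemma bop_mulDl : left_distributive bop_mul bop_add.
Proof. by move=> A B C; apply: bop_inj. Qed.
Lemma bop_mulDr : right_distributive bop_mul bop_add.
Proof. by move=> A B C; apply: bop_inj => f; exact: linearD. Qed.
HB.instance Definition _ := GRing.Zmodule_isPzRing.Build bop
  bop_mulA bop_mul1 bop_mulr1 bop_mulDl bop_mulDr.

Lemma bopM (A B : bop) f : (A * B) f = A (B f). Proof. by []. Qed.
Lemma bopD (A B : bop) f : (A + B) f = A f + B f. Proof. by []. Qed.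
Lemma bopN (A : bop) f : (- A) f = - A f. Proof. by []. Qed.
Lemma bopB (A B : bop) f : (A - B) f = A f - B f. Proof. by []. Qed.
Lemma bop1 f : (1 : bop) f = f. Proof. by []. Qed.
Lemma bop0 f : (0 : bop) f = 0. Proof. by []. Qed.
Definition bopE := (bopM, bopB, bopD, bopN, bop1, bop0).

(** Real scalars enter as central elements, so that all identities are identities in one ring. *)
Definition rscale (c : R) : bop := Bop (bounded_scale c).

Lemma rscaleC c A : rscale c * A = A * rscale c.
Proof. by apply: bop_inj => f; rewrite !bopE /= linearZ. Qed.

Lemma rscaleM c d : rscale c * rscale d = rscale (c * d).
Proof. by apply: bop_inj => f; rewrite !bopE /= scalerA -rmorphM. Qed.

Lemma rscale1 : rscale 1 = 1.
Proof. by apply: bop_inj => f; rewrite /= scale1r. Qed.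

Lemma rscaleD c d : rscale c + rscale d = rscale (c + d).
Proof. by apply: bop_inj => f; rewrite !bopE /= -scalerDl -rmorphD. Qed.

Definition half : bop := rscale 2^-1.

Lemma halfC A : half * A = A * half. Proof. exact: rscaleC. Qed.

Lemma half2 : half + half = 1.
Proof. by rewrite rscaleD -rscale1; congr rscale; field. Qed.

Lemma halfD A : half * (A + A) = A.
Proof. by rewrite mulrDr -mulrDl half2 mul1r. Qed.

(** Convergence in operator norm, stated with a null sequence of bounds so that no operator norm has
    to be defined. *)
Definition op_cvg (Y : nat -> bop) (L : bop) :=
  exists2 e : nat -> R, e @ \oo --> (0 : R) & forall n, op_le (L - Y n) (e n).

Lemma op_leB A B a b : op_le A a -> op_le B b -> op_le (A - B) (a + b).
Proof.
move=> Aa Bb f; rewrite bopB mulrDl.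
by apply: le_trans (rnormD _ _) _; rewrite rnormN lerD.
Qed.

Lemma op_leD A B a b : op_le A a -> op_le B b -> op_le (A + B) (a + b).
Proof.
move=> Aa Bb f; rewrite bopD mulrDl.
by apply: le_trans (rnormD _ _) _; rewrite lerD.
Qed.

Lemma op_leM A B a b : 0 <= a -> op_le A a -> op_le B b -> op_le (A * B) (a * b).
Proof.
by move=> a0 Aa Bb f; apply: le_trans (Aa _) _; rewrite -mulrA ler_wpM2l.
Qed.

Lemma op_le_weak A a b : a <= b -> op_le A a -> op_le A b.
Proof.
by move=> ab Aa f; apply: le_trans (Aa f) _; rewrite ler_wpM2r ?rnorm_ge0.
Qed.

Lemma op_cvg_cst A : op_cvg (fun=> A) A.
Proof.
exists (fun=> 0); first exact: cvg_cst.
by move=> n f; rewrite subrr /= mul0r rnorm0.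
Qed.

Lemma op_le_eq0 (A : bop) (e : nat -> R) :
  e @ \oo --> (0 : R) -> (forall n, op_le A (e n)) -> A = 0.
Proof.
move=> e0 Ae; apply: bop_inj => f; apply: rnorm_eq0; apply/eqP.
rewrite eq_le rnorm_ge0 andbT.
have : (fun n => e n * rnorm f) @ \oo --> 0 * rnorm f.
  by apply: cvgMr_tmp => //; exact: cvg_cst.
rewrite mul0r => ef0; rewrite -(cvg_lim _ ef0)//; apply: limr_ge.
  by apply/cvg_ex; exists 0.
by near=> n; exact: Ae.
Unshelve. all: by end_near. Qed.

Lemma op_cvg_unique Y L M : op_cvg Y L -> op_cvg Y M -> L = M.
Proof.
move=> [e e0 Le] [d d0 Md]; apply/subr0_eq.
apply: (@op_le_eq0 _ (fun n => e n + d n)) => [|n].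
  by rewrite -[0]addr0; exact: cvgD.
by rewrite -(subrKA (Y n)) -[Y n - M]opprB; apply: op_leB.
Qed.

Lemma op_cvgD Y L Y' L' : op_cvg Y L -> op_cvg Y' L' ->
  op_cvg (fun n => Y n + Y' n) (L + L').
Proof.
move=> [e e0 Le] [d d0 Md]; exists (fun n => e n + d n) => [|n].
  by rewrite -[0]addr0; exact: cvgD.
by rewrite opprD addrACA; exact: op_leD.
Qed.

Lemma op_cvgM Y L Y' L' : op_cvg Y L -> op_cvg Y' L' ->
  op_cvg (fun n => Y n * Y' n) (L * L').
Proof.
move=> [e e0 Le] [d d0 Md].
have normcvg0 (v : nat -> R) : v @ \oo --> (0 : R) ->
    (fun n => `|v n|) @ \oo --> (0 : R).
  by rewrite -[in X in _ -> X](normr0 R); exact: cvg_norm.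
have [l l0 Ll] := bop_bound L; have [m m0 Mm] := bop_bound L'.
(* A rate is assumed to tend to 0, not to be nonnegative, hence the absolute values. *)
exists (fun n => `|e n| * (m + `|d n|) + l * d n) => [|n].
  rewrite -[0]addr0; apply: cvgD.
    rewrite -[0](mul0r (m + 0)); apply: cvgM; first exact: normcvg0.
    by apply: cvgD; [exact: cvg_cst|exact: normcvg0].
  by rewrite -[0](mulr0 l); apply: cvgM => //; exact: cvg_cst.
have -> : L * L' - Y n * Y' n = (L - Y n) * Y' n + L * (L' - Y' n).
  by rewrite mulrBl mulrBr [RHS]addrC subrKA.
apply: op_leD; last exact: op_leM.
apply: op_leM => //; first by apply: op_le_weak (Le n); exact: ler_norm.
have -> : Y' n = L' - (L' - Y' n) by rewrite subKr.
by apply: op_leB => //; apply: op_le_weak (Md n); exact: ler_norm.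
Qed.

Lemma op_cvgS Y L : op_cvg Y L -> op_cvg (fun n => Y n.+1) L.
Proof.
move=> [e e0 Le]; exists (fun n => e n.+1) => //.
by rewrite (cvg_shiftS e).
Qed.

Lemma op_cvg_le Y L c : op_cvg Y L -> (forall n, op_le (Y n) c) -> op_le L c.
Proof.
move=> [e e0 Le] Yc f.
have : (fun n => (e n + c) * rnorm f) @ \oo --> (0 + c) * rnorm f.
  apply: cvgM; last exact: cvg_cst.
  by apply: cvgD => //; exact: cvg_cst.
rewrite add0r => ef; rewrite -(cvg_lim _ ef)//; apply: limr_ge.
  by apply/cvg_ex; eexists; exact: ef.
near=> n; rewrite -[L](subrK (Y n)); exact: op_leD.
Unshelve. all: by end_near. Qed.

Lemma op_cauchy_cvg (Y : nat -> bop) (e : nat -> R) : e @ \oo --> (0 : R) ->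
  (forall m n, (m <= n)%N -> op_le (Y n - Y m) (e m)) -> exists L, op_cvg Y L.
Proof.
move=> e0 Ye.
have e0f c : (fun n => e n * c) @ \oo --> (0 : R).
  by rewrite -(mul0r c); apply: cvgM => //; exact: cvg_cst.
have /choice[L LY] f : exists l, (fun n => Y n f) @ \oo --> l /\
    forall n, rnorm (l - Y n f) <= e n * rnorm f.
  have [|l lc le] := cauchy_rate_limit (e0f (rnorm f)) (u := fun n => Y n f).
    by move=> m n mn; exact: (Ye m n mn f).
  by exists l.
have linL : linear L.
  move=> a f g; rewrite -(cvg_lim (@norm_hausdorff _ K) (LY (a *: f + g)).1).
  apply: cvg_lim; first exact: norm_hausdorff.
  under eq_fun do rewrite linearP.
  apply: cvgD; last exact: (LY g).1.
  apply: cvgZl_tmp; exact: (LY f).1.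
have bL : bounded_op L.
  apply/bounded_opP => //; have [c c0 Yc] := bop_bound (Y 0%N).
  exists (`|e 0%N| + c) => [|f]; first exact: addr_ge0.
  rewrite -[L f](subrK (Y 0%N f)) mulrDl; apply: le_trans (rnormD _ _) _.
  apply: lerD => //; apply: le_trans ((LY f).2 _) _.
  by rewrite ler_wpM2r ?rnorm_ge0 ?ler_norm.
exists (Bop bL); exists e => // n f; exact: (LY f).2.
Qed.

End BoundedOperators.

Reserved Notation "A ^h" (at level 2, format "A ^h").

(** * Adjoints and positivity *)

Section Adjoint.
Context (R : realType) (K : completeNormedModType R[i]).
Context (dot : {dot K for Num.conj}).
Context (norm_inner : forall f : K, `|f| ^+ 2 = inner dot f f).
Implicit Types (A B S T : bop K) (f g h : K).
Local Notation ip := (rip dot).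
Local Notation rsq := (rnorm_sqr norm_inner).

Lemma ripBr f g h : ip f (g - h) = ip f g - ip f h.
Proof. by rewrite ripDr ripNr. Qed.

Lemma adjoint_exists A : exists B : bop K, forall f g, ip (B f) g = ip f (A g).
Proof.
have [a a0 Aa] := bop_bound A.
have /choice[B BA] f : exists h, forall g, ip h g = ip f (A g).
  (* Riesz representation: [T] is the identity, with bound 1. *)
  apply: (@real_additive_riesz _ _ _ norm_inner id _ 1 (rnorm f * a)) => //.
  - by move=> g; rewrite rsq.
  - by move=> g; rewrite mul1r.
  - by move=> g h; rewrite linearD ripDr.
  - by move=> c g; rewrite linearZ ripZr.
  - move=> g; apply: le_trans (rip_normr norm_inner _ _) _.
    by rewrite -mulrA ler_wpM2l ?rnorm_ge0.
have linB : linear B.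
  move=> c f g; apply: (rip_inj norm_inner) => h.
  have ripZlC k u v : ip (k *: u) v = ip u (Num.conj k *: v).
    by rewrite /rip innerZl innerZr.
  by rewrite ripDl ripZlC !BA linearZ -ripZlC ripDl.
have bB : bounded_op B.
  apply/bounded_opP => //; exists a => // f.
  have [->|Bf0] := eqVneq (rnorm (B f)) 0; first by rewrite mulr_ge0 ?rnorm_ge0.
  have Bf_gt0 : 0 < rnorm (B f) by rewrite lt_def Bf0 rnorm_ge0.
  rewrite -(ler_pM2r Bf_gt0) -expr2 (rsq) BA.
  apply: le_trans (rip_normr norm_inner _ _) _.
  by rewrite mulrAC mulrC [a * _]mulrC ler_wpM2r ?rnorm_ge0// mulrC.
by exists (Bop bB).
Qed.

(** Characterized by the real inner product alone; because [A] is complex linear this is the same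
    operator as [adj], as [adjE] shows. *)
Definition adjb A : bop K := xget (0 : bop K) [set B : bop K | forall f g, ip (B f) g = ip f (A g)].
Local Notation "A ^h" := (adjb A) : ring_scope.

Lemma adjP A f g : ip (A^h f) g = ip f (A g).
Proof.
rewrite /adjb; case: xgetP => [B _ ->//|noB].
by have [B BA] := adjoint_exists A; case: (noB B).
Qed.

Lemma adjPr A f g : ip f (A^h g) = ip (A f) g.
Proof. by rewrite ripC adjP ripC. Qed.

Lemma bop_ripP A B : (forall f g, ip (A f) g = ip (B f) g) -> A = B.
Proof. by move=> AB; apply: bop_inj => f; apply: (rip_inj norm_inner). Qed.

Lemma adj_unique A B : (forall f g, ip (B f) g = ip f (A g)) -> A^h = B.
Proof. by move=> BA; apply: bop_ripP => f g; rewrite adjP BA. Qed.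

Lemma adjK : involutive adjb.
Proof. by move=> A; apply: adj_unique => f g; rewrite adjPr. Qed.

Lemma adjM A B : (A * B)^h = B^h * A^h.
Proof. by apply: adj_unique => f g; rewrite !bopE !adjP. Qed.

Lemma adjD A B : (A + B)^h = A^h + B^h.
Proof. by apply: adj_unique => f g; rewrite !bopE ripDl !adjP -ripDr. Qed.

Lemma adjN A : (- A)^h = - A^h.
Proof. by apply: adj_unique => f g; rewrite !bopE ripNl !adjP -ripNr. Qed.

Lemma adjB A B : (A - B)^h = A^h - B^h.
Proof. by rewrite adjD adjN. Qed.

Lemma adj1 : 1^h = 1.
Proof. by apply: adj_unique. Qed.

Lemma adj_rscale c : (rscale K c)^h = rscale K c.
Proof. by apply: adj_unique => f g; rewrite /= ripZl ripZr. Qed.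

(** Symmetry has to be required here, because only the real part of the form is constrained:
    multiplication by [i] satisfies [ip f (A f) = 0] without being symmetric. *)
Definition pos A := A^h = A /\ forall f, 0 <= ip f (A f).

Lemma pos_adj A : pos A -> A^h = A. Proof. by case. Qed.

Lemma posD A B : pos A -> pos B -> pos (A + B).
Proof.
move=> [Ah A0] [Bh B0]; split=> [|f]; first by rewrite adjD Ah Bh.
by rewrite ripDr addr_ge0.
Qed.

Lemma pos_congr A B : pos A -> pos (B^h * A * B).
Proof.
move=> [Ah A0]; split=> [|f]; first by rewrite !adjM adjK Ah mulrA.
by rewrite !bopE adjPr.
Qed.

Lemma pos1 : pos 1.
Proof. by split=> [|f]; rewrite ?adj1// -rsq// sqr_ge0. Qed.

Lemma pos_sqr A : pos (A^h * A).
Proof. by rewrite -[A^h]mulr1; exact/pos_congr/pos1. Qed.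

Lemma pos_sqr_sym A : A^h = A -> pos (A * A).
Proof. by move=> Ah; have := pos_sqr A; rewrite Ah. Qed.

Lemma pos0 : pos 0.
Proof. by have := pos_sqr 0; rewrite mulr0. Qed.

Lemma pos_cauchy A f g : pos A -> ip f (A g) ^+ 2 <= ip f (A f) * ip g (A g).
Proof.
move=> [Ah A0]; apply: discriminant_le => // t.
have := A0 (t%:C *: f + g); rewrite linearD linearZ !ripE.
rewrite (ripC dot g (A f)) -(adjPr A f g) Ah.
by congr (0 <= _); ring.
Qed.

Lemma pos_ker A f : pos A -> ip f (A f) = 0 -> A f = 0.
Proof.
move=> posA Af0; apply: rnorm_eq0; apply/eqP.
have := pos_cauchy (A f) f posA; rewrite Af0 mulr0 -rsq// -exprM.
by rewrite real_exprn_even_le0 ?num_real.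
Qed.

Lemma op_le_adj A c : 0 <= c -> op_le A c -> op_le A^h c.
Proof.
move=> c0 Ac f.
have [->|Bf0] := eqVneq (rnorm (A^h f)) 0; first by rewrite mulr_ge0 ?rnorm_ge0.
have Bf_gt0 : 0 < rnorm (A^h f) by rewrite lt_def Bf0 rnorm_ge0.
rewrite -(ler_pM2r Bf_gt0) -expr2 (rsq) adjP.
apply: le_trans (rip_normr norm_inner _ _) _.
by rewrite [leRHS]mulrAC mulrC ler_wpM2r ?rnorm_ge0.
Qed.

(** Cauchy-Schwarz for the form of [A], at [A f] and [f], gives [|A f|^4 <= |A f|^2 |f|^2]. *)
Lemma pos_op_le A : pos A -> pos (1 - A) -> op_le A 1.
Proof.
move=> posA [_ A1] f; rewrite mul1r.
have A_le g : ip g (A g) <= rnorm g ^+ 2.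
  by have := A1 g; rewrite bopB ripBr subr_ge0 -rsq.
have [->|Af0] := eqVneq (rnorm (A f)) 0; first exact: rnorm_ge0.
have Af_gt0 : 0 < rnorm (A f) by rewrite lt_def Af0 rnorm_ge0.
rewrite -(@ler_pXn2r _ 2) ?nnegrE ?rnorm_ge0//.
rewrite -(@ler_pM2l _ (rnorm (A f) ^+ 2)) ?exprn_gt0// -expr2.
rewrite (rsq (A f)).
apply: le_trans (pos_cauchy _ _ posA) _.
by rewrite -(rsq (A f)) ler_pM//; case: posA.
Qed.

Lemma op_cvg_adj Y L : op_cvg Y L -> op_cvg (fun n => (Y n)^h) L^h.
Proof.
move=> [e e0 Le]; exists (fun n => `|e n|).
  by rewrite -(normr0 R); exact: cvg_norm.
move=> n; rewrite -adjB; apply: op_le_adj => //.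
by apply: op_le_weak (Le n); exact: ler_norm.
Qed.

(** The one place where an inverse is obtained by analysis; later inverses apply this lemma or are
    algebraic. The bound [|f|^2 <= ip f (T f)] gives injectivity of [T] and norm at most 1 for the
    inverse. *)
Lemma pos_inverse T : pos (T - 1) -> exists S, [/\ T * S = 1, S * T = 1 & S^h = S].
Proof.
move=> [T1h T1].
have Th : T^h = T by rewrite -[T](subrK 1) adjD T1h adj1.
have [m m0 Tm] := bop_bound T.
have T_ge f : rnorm f ^+ 2 <= ip f (T f).
  by have := T1 f; rewrite bopB ripBr subr_ge0 -rsq.
have /choice[S TS] f : exists h, T h = f.
  have [||||||||h Th_f] := @real_additive_riesz _ _ _ norm_inner T (ip f) m (rnorm f).
  - exact: linearD.
  - by move=> a g; exact: linearZ.
  - by move=> g h; rewrite -adjP Th.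
  - exact: T_ge.
  - exact: Tm.
  - by move=> g h; rewrite ripDr.
  - by move=> a g; rewrite ripZr.
  - exact: rip_normr.
  by exists h; apply: (rip_inj norm_inner).
have T_inj f : T f = 0 -> f = 0.
  move=> Tf0; apply: rnorm_eq0; apply/eqP; rewrite -sqrf_eq0 eq_le sqr_ge0 andbT.
  by apply: le_trans (T_ge f) _; rewrite Tf0 rip0r.
have linS : linear S.
  by move=> a f g; apply/subr0_eq/T_inj; rewrite linearB linearP /= !TS subrr.
have bS : bounded_op S.
  apply/bounded_opP => //; exists 1 => // f; rewrite mul1r.
  have [->|Sf0] := eqVneq (rnorm (S f)) 0; first exact: rnorm_ge0.
  have Sf_gt0 : 0 < rnorm (S f) by rewrite lt_def Sf0 rnorm_ge0.
  rewrite -(ler_pM2l Sf_gt0) -expr2; apply: le_trans (T_ge _) _.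
  by rewrite TS; exact: rip_normr.
have TS1 : T * Bop bS = 1 by apply: bop_inj.
have ST1 : Bop bS * T = 1.
  by apply: bop_inj => f; apply/subr0_eq/T_inj; rewrite linearB /= TS subrr.
exists (Bop bS); split=> //.
by rewrite -[LHS]mulr1 -TS1 mulrA -[X in _ * X * _]Th -adjM TS1 adj1 mul1r.
Qed.

End Adjoint.

(* Pairing with two vectors turns an identity between sums of operator words
   into one between real numbers; [bop_ring] first multiplies out. *)
Ltac bop_abel norm_inner :=
  apply: (bop_ripP norm_inner) => ? ?;
  rewrite ?(bopD, bopB, bopN, bop0) ?(ripDr, ripNr, rip0r); ring.
Ltac bop_ring norm_inner :=
  rewrite ?(mulrDl, mulrDr, mulNr, mulrN, mul1r, mulr1, mul0r, mulr0, mulrA);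
  bop_abel norm_inner.

(** * Square roots *)

Section SquareRoot.
Context (R : realType) (K : completeNormedModType R[i]).
Context (dot : {dot K for Num.conj}).
Context (norm_inner : forall f : K, `|f| ^+ 2 = inner dot f f).
Implicit Types (A B S T : bop K) (f g : K).
Local Notation ip := (rip dot).
Local Notation rsq := (rnorm_sqr norm_inner).
Local Notation pos := (pos dot).
Local Notation "A ^h" := (adjb dot A) : ring_scope.
Let adjM' := adjM norm_inner.
Let adjD' := adjD norm_inner.

(* [1 - sqrt A] is the fixed point of [Y |-> (1 - A + Y^2) / 2]; the same iteration
   on the scalar [1 - A = 1] bounds the norms and the increments. *)
Fixpoint sqrt_iter A n : bop K :=
  if n is m.+1 then half K * (1 - A + sqrt_iter A m * sqrt_iter A m) else 0.

Fixpoint sqrt_bound n : R :=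
  if n is m.+1 then (1 + sqrt_bound m ^+ 2) / 2 else 0.

Lemma sqrt_bound_ge0 n : 0 <= sqrt_bound n.
Proof. by case: n => //= n; rewrite divr_ge0// addr_ge0// sqr_ge0. Qed.

Lemma sqrt_bound_le1 n : sqrt_bound n <= 1.
Proof.
elim: n => //= n IH; have := sqrt_bound_ge0 n; nra.
Qed.

Lemma sqrt_bound_le n : sqrt_bound n <= sqrt_bound n.+1.
Proof. by rewrite /=; have := sqr_ge0 (1 - sqrt_bound n); lra. Qed.

Lemma sqrt_iter_comm A B n : A * B = B * A ->
  sqrt_iter A n * B = B * sqrt_iter A n.
Proof.
move=> AB; elim: n => [|n IH] /=; first by rewrite mul0r mulr0.
have XB : (1 - A + sqrt_iter A n * sqrt_iter A n) * B =
    B * (1 - A + sqrt_iter A n * sqrt_iter A n).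
  by rewrite mulrDl mulrDr mulrBl mulrBr mul1r mulr1 AB; congr (_ + _);
    rewrite -mulrA IH [LHS]mulrA IH mulrA.
by rewrite -mulrA XB mulrA halfC -mulrA.
Qed.

Lemma sqrt_iter_adj A n : A^h = A -> (sqrt_iter A n)^h = sqrt_iter A n.
Proof.
move=> Ah; elim: n => [|n IH] /=; first exact/(pos_adj (pos0 norm_inner)).
by rewrite adjM' adjD' adjB// adj1// Ah adjM' IH /half adj_rscale// -halfC.
Qed.

Lemma op_le_half A c : op_le A c -> op_le (half K * A) (c / 2).
Proof.
move=> Ac f.
by rewrite /= rnormZ ger0_norm ?invr_ge0// [leRHS]mulrAC [leRHS]mulrC ler_wpM2l ?invr_ge0.
Qed.

Lemma sqrt_iter_le A n : op_le (1 - A) 1 -> op_le (sqrt_iter A n) (sqrt_bound n).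
Proof.
move=> A1; elim: n => [f|n IH] /=; first by rewrite mul0r rnorm0.
apply: op_le_half; apply: op_leD => //; rewrite expr2.
by apply: op_leM => //; exact: sqrt_bound_ge0.
Qed.

(** Iterates commute, so the increment factors as [(Y - Z) (Y + Z) / 2]. The scalar increment
    factors in the same way and therefore dominates it. *)
Lemma sqrt_iter_diff A n : op_le (1 - A) 1 ->
  op_le (sqrt_iter A n.+1 - sqrt_iter A n) (sqrt_bound n.+1 - sqrt_bound n).
Proof.
move=> A1; elim: n => [|n IH].
  by rewrite !subr0; exact: sqrt_iter_le.
set Y := sqrt_iter A n.+1 in IH *; set Z := sqrt_iter A n in IH *.
have YZ : Y * Z = Z * Y.
  by apply: sqrt_iter_comm; apply/esym; exact: sqrt_iter_comm.
have -> : sqrt_iter A n.+2 - Y = half K * ((Y - Z) * (Y + Z)).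
  have iterS k : sqrt_iter A k.+1 = half K * (1 - A + sqrt_iter A k * sqrt_iter A k).
    by [].
  rewrite iterS -/Y {3}/Y iterS -/Z -mulrBr opprD addrACA subrr add0r.
  by congr (_ * _); rewrite mulrBl !mulrDr YZ opprD addrA addrK.
have -> : sqrt_bound n.+2 - sqrt_bound n.+1 =
    (sqrt_bound n.+1 - sqrt_bound n) * (sqrt_bound n.+1 + sqrt_bound n) / 2.
  have boundS k : sqrt_bound k.+1 = (1 + sqrt_bound k ^+ 2) / 2 by [].
  by rewrite (boundS n.+1); move: (boundS n); move: (sqrt_bound n.+1) => y; lra.
apply: op_le_half; apply: op_leM => //; first by rewrite subr_ge0 sqrt_bound_le.
by apply: op_leD; exact: sqrt_iter_le.
Qed.

Lemma sqrt_exists_le1 A : pos A -> pos (1 - A) ->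
  exists S, [/\ pos S, S * S = A & forall B, A * B = B * A -> S * B = B * S].
Proof.
move=> posA posA1.
have A1 : op_le (1 - A) 1 by apply: pos_op_le norm_inner _ posA1 _; rewrite subKr.
(* Only convergence of the scalar sequence matters: with limit [l], the null sequence [l - y n] is a
   Cauchy rate for the operators. *)
pose y := sqrt_bound.
have y_incr : nondecreasing_seq y.
  by apply/nondecreasing_seqP; exact: sqrt_bound_le.
have : cvgn y.
  apply: nondecreasing_is_cvgn => //.
  by exists 1 => _ [n _ <-]; exact: sqrt_bound_le1.
move=> /[dup] cvy; set l := lim _ => yl.
have diff m n : (m <= n)%N -> op_le (sqrt_iter A n - sqrt_iter A m) (y n - y m).
  move=> /subnK <-; elim: (n - m)%N => [|k IH].
    by rewrite add0n !subrr => f; rewrite mul0r rnorm0.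
  rewrite addSn -(subrKA (sqrt_iter A (k + m))) -(subrKA (y (k + m)%N)).
  by apply: op_leD => //; exact: sqrt_iter_diff.
have [|m n mn|L YL] := @op_cauchy_cvg _ _ (sqrt_iter A) (fun n => l - y n).
- by rewrite -[0](subrr l); apply: cvgB => //; exact: cvg_cst.
- apply: op_le_weak (diff _ _ mn); rewrite lerD2r.
  by apply: nondecreasing_cvgn_le.
have LE : L = half K * (1 - A + L * L).
  apply: op_cvg_unique (op_cvgS YL) _; apply: op_cvgM; first exact: op_cvg_cst.
  by apply: op_cvgD; [exact: op_cvg_cst|exact: op_cvgM].
have Lh : L^h = L.
  apply: op_cvg_unique (op_cvg_adj norm_inner YL) _.
  under eq_fun do rewrite (sqrt_iter_adj _ (pos_adj posA)).
  exact: YL.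
have L1 : op_le L 1.
  apply: op_cvg_le YL _ => n; apply: op_le_weak (sqrt_iter_le _ A1).
  exact: sqrt_bound_le1.
have LL : L + L = 1 - A + L * L.
  by rewrite {1 2}LE -mulrDl half2 mul1r.
exists (1 - L); split.
- split=> [|f]; first by rewrite adjB// adj1// Lh.
  rewrite bopB ripBr// subr_ge0 -rsq.
  apply: le_trans (rip_normr norm_inner _ _) _.
  by rewrite expr2 ler_wpM2l ?rnorm_ge0// -[leRHS]mul1r.
- have -> : (1 - L) * (1 - L) = 1 + L * L - (L + L) by bop_ring norm_inner.
  rewrite LL; bop_abel norm_inner.
- move=> B AB; rewrite mulrBl mulrBr mul1r mulr1; congr (_ - _).
  apply: op_cvg_unique (op_cvgM YL (op_cvg_cst B)) _.
  under eq_fun do rewrite (sqrt_iter_comm _ AB).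
  by apply: op_cvgM => //; exact: op_cvg_cst.
Qed.

(** The commutation clause does the work of a functional calculus: it makes roots unique and lets
    them pass through every operator that commutes with [A]. Dividing by a bound of [A] reduces the
    claim to an operator between 0 and 1. *)
Lemma sqrt_exists A : pos A ->
  exists S, [/\ pos S, S * S = A & forall B, A * B = B * A -> S * B = B * S].
Proof.
move=> posA; have [c c0 Ac] := bop_bound A.
have [a a_gt0 Aa] : exists2 a, 0 < a & op_le A a.
  exists (c + 1); first by rewrite ltr_wpDl.
  by apply: op_le_weak Ac; rewrite lerDl.
have pos_scale d B : 0 <= d -> pos B -> pos (rscale K d * B).
  move=> d0 [Bh B0]; split=> [|f]; last by rewrite /= ripZr mulr_ge0.
  by rewrite adjM' Bh adj_rscale// rscaleC.
have [||S [posS SS SC]] := @sqrt_exists_le1 (rscale K a^-1 * A).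
- by apply: pos_scale => //; rewrite invr_ge0 ltW.
- split=> [|f]; first by rewrite adjB// adj1// adjM' adj_rscale// (pos_adj posA) rscaleC.
  rewrite bopB ripBr// subr_ge0 /= ripZr -rsq ler_pdivrMl// mulrC.
  apply: le_trans (rip_normr norm_inner _ _) _.
  by rewrite expr2 -mulrA ler_wpM2l ?rnorm_ge0// mulrC.
exists (rscale K (Num.sqrt a) * S); split.
- by apply: pos_scale => //; exact: sqrtr_ge0.
- rewrite mulrA -(mulrA _ S) -rscaleC mulrA rscaleM -mulrA SS mulrA rscaleM.
  by rewrite -expr2 sqr_sqrtr ?ltW// divff ?gt_eqF// rscale1 mul1r.
- move=> B AB; have SB : S * B = B * S.
    by apply: SC; rewrite -mulrA AB mulrA rscaleC -mulrA.
  by rewrite -mulrA SB mulrA rscaleC -mulrA.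
Qed.

(** Commutation gives [(S + T) D = 0] for [D = S - T]. The forms of [S] and [T] at [D f] are
    nonnegative with sum 0, so both operators kill [D f], whence [D D f = 0]. *)
Lemma sqrt_unique A S T : pos S -> pos T -> S * S = A -> T * T = A ->
  S * T = T * S -> S = T.
Proof.
move=> posS posT SS TT ST; apply/subr0_eq; set D := S - T.
have Dh : D^h = D by rewrite adjB// (pos_adj posS) (pos_adj posT).
have D0 : (S + T) * D = 0.
  by rewrite mulrDl !mulrBr SS TT ST addrA subrK subrr.
apply: (bop_inj) => f; apply: rnorm_eq0; apply/eqP; rewrite -sqrf_eq0 rsq.
have : ip (D f) (S (D f)) + ip (D f) (T (D f)) = 0.
  by rewrite -ripDr -!bopM -bopD -mulrDl D0 rip0r.
move=> /eqP; rewrite paddr_eq0 ?posS.2 ?posT.2// => /andP[/eqP S0 /eqP T0].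
rewrite -{1}Dh adjP// -(bopM D D) mulrBl.
by rewrite bopB !bopM (pos_ker norm_inner posS S0) (pos_ker norm_inner posT T0) subrr rip0r.
Qed.

End SquareRoot.

(** * Hilbert-Schmidt operators *)

Section HilbertSchmidt.
Context (R : realType) (K : completeNormedModType R[i]).
Context (dot : {dot K for Num.conj}).
Context (norm_inner : forall f : K, `|f| ^+ 2 = inner dot f f).
Implicit Types (A B : bop K) (f g : K).
Local Notation ip := (rip dot).
Local Notation rsq := (rnorm_sqr norm_inner).
Local Notation "A ^h" := (adjb dot A) : ring_scope.

Definition real_orthonormal (b : nat -> K) := forall j k, ip (b j) (b k) = (j == k)%:R.
Definition real_total (b : nat -> K) := forall f, (forall k, ip (b k) f = 0) -> f = 0.

Lemma rip_sumr f I (r : seq I) (P : pred I) (u : I -> K) :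
  ip f (\sum_(i <- r | P i) u i) = \sum_(i <- r | P i) ip f (u i).
Proof. by apply: (big_morph (ip f)) => [g h|]; rewrite ?ripDr ?rip0r. Qed.

(** * Bessel's inequality and Parseval's identity *)

Section RealBasis.
Variables (b : nat -> K) (b_on : real_orthonormal b).

Let coef f k := ip (b k) f.
Let proj f n := \sum_(k < n) (coef f k)%:C *: b k.

Lemma coef_proj f n k : (k < n)%N -> coef (proj f n) k = coef f k.
Proof.
move=> kn; rewrite /coef /proj rip_sumr (bigD1 (Ordinal kn))//= ripZr b_on eqxx.
rewrite mulr1 big1 ?addr0// => i ik; rewrite ripZr b_on.
case: eqP => [ki|]; last by rewrite mulr0.
by move: ik; rewrite -val_eqE/= ki eqxx.
Qed.

Lemma rnorm_proj f n : rnorm (proj f n) ^+ 2 = \sum_(k < n) coef f k ^+ 2.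
Proof.
rewrite rsq {2}/proj rip_sumr; apply: eq_bigr => k _.
by rewrite ripZr ripC -/(coef _ _) coef_proj.
Qed.

Lemma rnorm_sub_proj f n :
  rnorm (f - proj f n) ^+ 2 = rnorm f ^+ 2 - \sum_(k < n) coef f k ^+ 2.
Proof.
have fp : ip f (proj f n) = \sum_(k < n) coef f k ^+ 2.
  rewrite rip_sumr; apply: eq_bigr => k _; by rewrite ripZr ripC.
by rewrite rsq !ripE (ripC dot (proj f n)) fp -rsq -rsq rnorm_proj; ring.
Qed.

Lemma bessel f n : \sum_(k < n) ip (b k) f ^+ 2 <= rnorm f ^+ 2.
Proof. by rewrite -subr_ge0 -rnorm_sub_proj sqr_ge0. Qed.

(** The projections are Cauchy with rate [sqrt (l - S n)], where [l] is the limit of the partial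
    sums. Their limit has the same coefficients as [f], so totality identifies it with [f]. *)
Lemma parseval (b_total : real_total b) f :
  (fun n => \sum_(k < n) ip (b k) f ^+ 2) @ \oo --> rnorm f ^+ 2.
Proof.
pose S n := \sum_(k < n) coef f k ^+ 2.
have S_incr : nondecreasing_seq S.
  by apply/nondecreasing_seqP => n; rewrite /S big_ord_recr lerDl sqr_ge0.
have : cvgn S.
  apply: nondecreasing_is_cvgn => //.
  by exists (rnorm f ^+ 2) => _ [n _ <-]; exact: bessel.
move=> /[dup] cvS; set l := lim _ => Sl.
have Sle n : S n <= l by exact: nondecreasing_cvgn_le.
pose e n := Num.sqrt (l - S n).
have e0 : e @ \oo --> (0 : R).
  have d0 : (fun n => l - S n) @ \oo --> (0 : R).
    by rewrite -[0](subrr l); apply: cvgB => //; exact: cvg_cst.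
  by have := cvg_comp _ _ d0 (@sqrt_continuous R 0); rewrite sqrtr0.
have proj_diff m n : (m <= n)%N -> rnorm (proj f n - proj f m) <= e m.
  move=> mn; rewrite -(@ler_pXn2r _ 2) ?nnegrE ?rnorm_ge0 ?sqrtr_ge0//.
  rewrite sqr_sqrtr ?subr_ge0//.
  have cross : ip (proj f n) (proj f m) = S m.
    rewrite [proj f m]/proj rip_sumr; apply: eq_bigr => k _.
    by rewrite ripZr ripC -/(coef _ _) coef_proj// (leq_trans _ mn).
  rewrite rsq !ripE (ripC dot (proj f m) (proj f n)) cross -!rsq !rnorm_proj.
  rewrite -!/(S _); have := Sle n; lra.
have [g _ gp] := cauchy_rate_limit e0 proj_diff.
suff fg : f = g.
  have -> : rnorm f ^+ 2 = l; last exact: Sl.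
  apply/eqP; rewrite eq_le; apply/andP; split; last first.
    by apply: limr_le => //; near=> n; exact: bessel.
  (* At index 0 the projection and the partial sum are both 0, so the rate reads
     [rnorm f <= sqrt l]. *)
  have := gp 0%N; rewrite -fg /proj big_ord0 subr0 /e /S big_ord0 subr0 => fl.
  have l0 : 0 <= l by have := Sle 0%N; rewrite /S big_ord0.
  by rewrite -(sqr_sqrtr l0) ler_pXn2r ?nnegrE ?rnorm_ge0 ?sqrtr_ge0.
apply/subr0_eq/b_total => j; apply/eqP; rewrite -normr_le0.
have b1 : rnorm (b j) = 1.
  apply/eqP; rewrite -(@eqrXn2 _ 2) ?rnorm_ge0// rsq b_on eqxx.
  by rewrite expr1n.
rewrite -(cvg_lim _ e0)//; apply: limr_ge; first by apply/cvg_ex; exists 0.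
near=> n.
have -> : ip (b j) (f - g) = - ip (b j) (g - proj f n).
  rewrite !ripE -/(coef (proj f n) j) coef_proj; last by near: n; exists j.+1.
  by rewrite /coef; ring.
rewrite normrN; apply: le_trans (ler_rip norm_inner _ _) _.
by rewrite b1 mul1r.
Unshelve. all: by end_near. Qed.

End RealBasis.

(** * The Hilbert-Schmidt condition, its independence of the basis, and the ideal property *)

Definition real_hs (b : nat -> K) A :=
  exists c : R, forall n, \sum_(k < n) rnorm (A (b k)) ^+ 2 <= c.

(** Exchange of a double sum of squared coefficients: Parseval in [b] expands the left-hand norms,
    and Bessel in [b'] recombines them. Allowing two bases is what makes the condition independent
    of the basis. *)
Lemma real_hs_adj b b' A : real_orthonormal b -> real_total b ->
  real_orthonormal b' -> real_hs b A -> real_hs b' A^h.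
Proof.
move=> b_on b_total b'_on [c Ac]; exists c => n.
have cvgS : (fun m => \sum_(k < n) \sum_(j < m) ip (b j) (A^h (b' k)) ^+ 2) @ \oo -->
    \sum_(k < n) rnorm (A^h (b' k)) ^+ 2.
  elim: n => [|n IH].
    by rewrite big_ord0; under eq_fun do rewrite big_ord0; exact: cvg_cst.
  rewrite big_ord_recr/=; under eq_fun do rewrite big_ord_recr/=.
  by apply: cvgD => //; exact: parseval.
rewrite -(cvg_lim _ cvgS)//; apply: limr_le; first by apply/cvg_ex; eexists; exact: cvgS.
near=> m; rewrite exchange_big/=; apply: le_trans (Ac m).
apply: ler_sum => j _; apply: le_trans (bessel b'_on (A (b j)) n).
by apply: ler_sum => k _; rewrite adjPr// ripC.
Unshelve. all: by end_near. Qed.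

(* The real orthonormal basis [e_0, i e_0, e_1, i e_1, ...] for [Re <., .>] attached
   to a complex one, so that Parseval is only needed with real coefficients. *)
Definition realify (e : nat -> K) k := if odd k then 'i%C *: e k./2 else e k./2.

Lemma ip_i f g : ip ('i%C *: f) ('i%C *: g) = ip f g.
Proof.
rewrite /rip innerZl innerZr mulrA.
suff -> : Num.conj ('i%C : R[i]) * 'i%C = 1 by rewrite mul1r.
by apply/eqP; rewrite eq_complex/=; apply/andP; split; apply/eqP; ring.
Qed.

Lemma realify_orthonormal e : orthonormal_basis dot e -> real_orthonormal (realify e).
Proof.
move=> [e_on _] j k; rewrite /realify -[in RHS](odd_double_half j) -[in RHS](odd_double_half k).
have ee m n : ip (e m) (e n) = (m == n)%:R by rewrite /rip e_on; case: eqP.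
have ei m n : ip (e m) ('i%C *: e n) = 0.
  by rewrite rip_i e_on; case: eqP => _ /=; rewrite oppr0.
have dbl (m n : nat) : (m.*2 == n.*2) = (m == n) by rewrite -!muln2 eqn_pmul2r.
case: (odd j); case: (odd k) => /=; rewrite ?ip_i ?ee ?(ripC _ ('i%C *: _)) ?ei.
- by rewrite !add1n eqSS dbl.
- rewrite add1n add0n; case: eqP => // /(congr1 odd).
  by rewrite /= !odd_double.
- rewrite add1n add0n; case: eqP => // /(congr1 odd).
  by rewrite /= !odd_double.
- by rewrite !add0n dbl.
Qed.

Lemma realify_total e : orthonormal_basis dot e -> real_total (realify e).
Proof.
move=> [_ e_total] f f0; apply: e_total => n.
have re0 := f0 n.*2; have im0 := f0 n.*2.+1.
move: re0 im0; rewrite /realify /= odd_double /= doubleK uphalf_double.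
rewrite [ip ('i%C *: _) _]ripC rip_i innerC /rip.
case: (inner dot (e n) f) => x y /= -> /eqP; rewrite oppr_eq0 oppr_eq0.
by move=> /eqP ->.
Qed.

(** The same formula as [real_hs], meant for complex orthonormal bases. Keeping [e] as a parameter
    lets one basis serve for all operators of a computation. *)
Definition hs (e : nat -> K) A := exists c : R, forall n, \sum_(k < n) rnorm (A (e k)) ^+ 2 <= c.

Lemma rnorm_i f : rnorm ('i%C *: f) = rnorm f.
Proof. by apply/eqP; rewrite -(@eqrXn2 _ 2) ?rnorm_ge0// !rsq ip_i. Qed.

Lemma hs_realify e A : hs e A <-> real_hs (realify e) A.
Proof.
have dbl n : \sum_(k < n.*2) rnorm (A (realify e k)) ^+ 2 =
    2 * \sum_(k < n) rnorm (A (e k)) ^+ 2.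
  elim: n => [|n IH]; first by rewrite !big_ord0 mulr0.
  rewrite doubleS !big_ord_recr/= IH /realify/= odd_double/= doubleK uphalf_double.
  by rewrite linearZ/= rnorm_i; ring.
have widen m n : (m <= n)%N -> forall u : nat -> K,
    \sum_(k < m) rnorm (u k) ^+ 2 <= \sum_(k < n) rnorm (u k) ^+ 2.
  move=> mn u; rewrite (big_ord_widen n (fun k => rnorm (u k) ^+ 2))//.
  by rewrite [leRHS](bigID (fun k : 'I_n => (k < m)%N))/= lerDl sumr_ge0// => k _; rewrite sqr_ge0.
split=> -[c Ac].
  (* The cutoff [n] may separate a vector from its multiple by [i]; enlarging it to [n.*2] keeps the
     pairs together. *)
  exists (2 * c) => n; apply: le_trans (widen n n.*2 _ (fun k => A (realify e k))) _.
    by rewrite -addnn leq_addr.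
  by rewrite dbl ler_pM2l.
exists c => n; apply: le_trans (Ac n.*2); rewrite dbl.
by rewrite mulr_natl mulr2n lerDl sumr_ge0// => k _; rewrite sqr_ge0.
Qed.

Lemma hs_adj e e' A : orthonormal_basis dot e -> orthonormal_basis dot e' ->
  hs e A -> hs e' A^h.
Proof.
move=> e_b e'_b /hs_realify Ae; apply/hs_realify.
by apply: (real_hs_adj _ _ _ Ae);
  [exact: realify_orthonormal|exact: realify_total|exact: realify_orthonormal].
Qed.

(** Each passage to the adjoint may change the basis, and two passages return to [A]. *)
Lemma hs_basis e e' A : orthonormal_basis dot e -> orthonormal_basis dot e' ->
  hs e A -> hs e' A.
Proof.
move=> e_b e'_b Ae; rewrite -[A](adjK norm_inner).
exact: hs_adj (hs_adj e_b e_b Ae).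
Qed.

Lemma hsD e A B : hs e A -> hs e B -> hs e (A + B).
Proof.
move=> [a Aa] [b Bb]; exists (2 * a + 2 * b) => n.
apply: (@le_trans _ _ (\sum_(k < n) (2 * rnorm (A (e k)) ^+ 2 + 2 * rnorm (B (e k)) ^+ 2))).
  apply: ler_sum => k _; rewrite bopD !rsq.
  have := sqr_ge0 (rnorm (A (e k) - B (e k))); rewrite rsq !ripE (ripC dot (B _) (A _)).
  lra.
rewrite big_split/= -!mulr_sumr.
by apply: lerD; rewrite ler_pM2l//; [exact: Aa|exact: Bb].
Qed.

Lemma hsN e A : hs e A -> hs e (- A).
Proof. by move=> [a Aa]; exists a => n; under eq_bigr do rewrite bopN rnormN. Qed.

Lemma hsB e A B : hs e A -> hs e B -> hs e (A - B).
Proof. by move=> Aa Bb; apply: hsD => //; exact: hsN. Qed.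

Lemma hsMl e A B : hs e A -> hs e (B * A).
Proof.
move=> [a Aa]; have [b b0 Bb] := bop_bound B; exists (b ^+ 2 * a) => n.
apply: (@le_trans _ _ (\sum_(k < n) b ^+ 2 * rnorm (A (e k)) ^+ 2)).
  apply: ler_sum => k _; rewrite -exprMn ler_pXn2r ?nnegrE ?mulr_ge0 ?rnorm_ge0//.
  exact: Bb.
by rewrite -mulr_sumr ler_wpM2l// sqr_ge0.
Qed.

Lemma hsMr e A B : orthonormal_basis dot e -> hs e A -> hs e (A * B).
Proof.
move=> e_b Ae; rewrite -[_ * _](adjK norm_inner) adjM//.
by apply: (hs_adj e_b e_b); apply/hsMl/(hs_adj e_b e_b).
Qed.

Lemma hilbert_schmidtE A : hilbert_schmidt dot A <->
  exists2 e, orthonormal_basis dot e & hs e A.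
Proof.
have ReE f : complex.Re (`|f| ^+ 2) = rnorm f ^+ 2.
  by rewrite rnormE -(rmorphXn (real_complex R)).
split=> [[_ [e [e_b Ae]]]|[e e_b [c Ac]]].
  exists e => //; pose s := (\sum_(0 <= n <oo) (complex.Re (`|A (e n)| ^+ 2))%:E)%E.
  have s_ge n : ((\sum_(k < n) rnorm (A (e k)) ^+ 2)%:E <= s)%E.
    rewrite -sumEFin -(big_mkord xpredT (fun k => (rnorm (A (e k)) ^+ 2)%:E)).
    under eq_bigr do rewrite -ReE.
    apply: nneseries_lim_ge => k _ _.
    by rewrite lee_fin ReE sqr_ge0.
  have s_fin : s \is a fin_num.
    rewrite ge0_fin_numE// ; apply: le_trans (s_ge 0%N).
    by rewrite big_ord0.
  by exists (fine s) => n; rewrite -lee_fin fineK.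
split; first exact: bopP.
exists e; split=> //; apply: (@le_lt_trans _ _ c%:E); last exact: ltry.
apply: lime_le; first by apply: is_cvg_nneseries => k _ _; rewrite lee_fin ReE sqr_ge0.
near=> n; under eq_bigr do rewrite ReE.
by rewrite big_mkord sumEFin lee_fin.
Unshelve. all: by end_near. Qed.

End HilbertSchmidt.

(** * Operators given by characteristic properties *)

Section Bridge.
Context (R : realType) (K : completeNormedModType R[i]).
Context (dot : {dot K for Num.conj}).
Context (norm_inner : forall f : K, `|f| ^+ 2 = inner dot f f).
Implicit Types (A B E S T : bop K) (f g : K).
Local Notation ip := (rip dot).
Local Notation pos := (pos dot).
Local Notation "A ^h" := (adjb dot A) : ring_scope.

Lemma bop_fun_inj A B : bop_fun A = bop_fun B -> A = B.
Proof. by move=> AB; apply: bop_inj => f; rewrite AB. Qed.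

Lemma inner_eq f g f' g' : ip f g = ip f' g' -> ip f ('i%C *: g) = ip f' ('i%C *: g') ->
  inner dot f g = inner dot f' g'.
Proof.
rewrite !rip_i => re /oppr_inj im; apply/eqP.
by rewrite eq_complex -/(rip dot f g) -/(rip dot f' g') re im !eqxx.
Qed.

Lemma inner_adj A B : (forall f g, inner dot (B f) g = inner dot f (A g)) <-> B = A^h.
Proof.
split=> [BA|-> f g]; first by rewrite (@adj_unique _ _ _ norm_inner A B)// => f g; rewrite /rip BA.
by apply: inner_eq; rewrite adjP// linearZ.
Qed.

Lemma adjE A : adj dot A = A^h.
Proof.
apply: xget_subset1 => [|B B' [bB BA] [bB' B'A]].
  by split; [exact: bopP|apply/inner_adj].
have /inner_adj E : forall f g, inner dot (Bop bB f) g = inner dot f (A g) := BA.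
have /inner_adj E' : forall f g, inner dot (Bop bB' f) g = inner dot f (A g) := B'A.
by rewrite -[B]/(bop_fun (Bop bB)) E -E'.
Qed.

Lemma self_adjointE A : self_adjoint dot A <-> A^h = A.
Proof.
split=> [[_ Ah]|Ah]; first by apply/esym/inner_adj.
by split; [exact: bopP|apply/inner_adj].
Qed.

Lemma scale_ii f : 'i%C *: ('i%C *: f) = - f.
Proof. by rewrite scalerA -expr2 sqr_i scaleN1r. Qed.

(** That a complex number is nonnegative includes that it is real. Polarizing the vanishing
    imaginary part of the form, with [i g] for [g], gives the symmetry of [A]. *)
Lemma positive_opE A : positive_op dot A <-> pos A.
Proof.
split=> [[_ A0]|[Ah A0]].
  have im0 f : ip f (A ('i%C *: f)) = 0.
    by rewrite linearZ rip_i ger0_Im ?oppr0.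
  have polar f g : ip f (A ('i%C *: g)) + ip g (A ('i%C *: f)) = 0.
    have := im0 (f + g); rewrite scalerDr linearD/= ripDl !ripDr !im0.
    by rewrite add0r addr0.
  split=> [|f]; last by have := A0 f; rewrite lecE => /andP[].
  apply: adj_unique => // f g; have := polar f ('i%C *: g).
  rewrite scale_ii linearN [A ('i%C *: f)]linearZ/= ip_i ripNr (ripC _ g).
  by move/eqP; rewrite addrC subr_eq0 => /eqP.
split=> [|f]; first exact: bopP.
rewrite lecE -/(rip dot f (A f)) A0 andbT; apply/eqP/oppr_inj; rewrite oppr0 -rip_i.
have e1 : ip f ('i%C *: A f) = ip ('i%C *: f) (A f).
  by rewrite -[in LHS]linearZ -adjP// Ah ripC.
have e2 : ip f ('i%C *: A f) = - ip ('i%C *: f) (A f).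
  by rewrite -(ip_i dot f) scale_ii ripNr.
by move: e1 e2 => -> /=; lra.
Qed.

(** Two arbitrary roots are not known to commute, so each is compared with the root from
    [sqrt_exists], which commutes with both. *)
Lemma sqrt_opE A S : pos S -> S * S = A -> sqrt_op dot A = S.
Proof.
move=> posS SS; apply: xget_unique => [|T [posT TT]].
  by split; [exact/positive_opE|rewrite -SS].
have [bT _] := posT; have {}posT : pos (Bop bT) by exact/positive_opE.
have {}TT : Bop bT * Bop bT = A by apply: bop_fun_inj.
suff E : Bop bT = S by rewrite -E.
have [|S0 [posS0 SS0 comm0]] := @sqrt_exists _ _ _ norm_inner A.
  by rewrite -SS -{1}(pos_adj posS); exact: pos_sqr.
rewrite -(sqrt_unique norm_inner posS0 posT SS0 TT); last first.
  by apply: comm0; rewrite -TT mulrA.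
apply: (sqrt_unique norm_inner posS0 posS SS0 SS).
by apply: comm0; rewrite -SS mulrA.
Qed.

Lemma abs_opE A S : pos S -> S * S = A^h * A -> abs_op dot A = S.
Proof. by move=> posS SS; rewrite /abs_op adjE; exact: (sqrt_opE posS SS). Qed.

(** In every admissible decomposition the sum of the two parts is the positive root of [A * A],
    hence determined by [A]; so is the positive part, as half of [A] plus that root. *)
Lemma pos_partE A S T : pos S -> pos T -> A = S - T -> S * T = 0 -> pos_part dot A = S.
Proof.
move=> posS posT AST ST0.
have abs U V : pos U -> pos V -> A = U - V -> U * V = 0 ->
    sqrt_op dot (A * A) = U + V.
  move=> posU posV AUV UV0; apply: sqrt_opE; first exact: posD.
  have VU0 : V * U = 0.
    rewrite -(pos_adj posU) -(pos_adj posV) -adjM// UV0.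
    exact: pos_adj (pos0 norm_inner).
  by rewrite AUV !(mulrDl, mulrDr, mulrN, mulNr) UV0 VU0; bop_abel norm_inner.
apply: xget_unique => [|U [posU [V [posV AUV UV0]]]].
  split; first exact/positive_opE.
  exists T; split; first exact/positive_opE.
    by rewrite AST.
  by apply/funext => f; rewrite -[LHS]/((S * T) f) ST0.
have [bU _] := posU; have [bV _] := posV.
have {}posU : pos (Bop bU) by exact/positive_opE.
have {}posV : pos (Bop bV) by exact/positive_opE.
have {}AUV : A = Bop bU - Bop bV by apply: bop_fun_inj.
have {}UV0 : Bop bU * Bop bV = 0 by apply: bop_fun_inj.
suff E : Bop bU = S by rewrite -E.
have UVST : Bop bU + Bop bV = S + T.
  by apply: bop_fun_inj; rewrite -(abs _ _ posS posT AST ST0) -(abs _ _ posU posV AUV UV0).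
rewrite -[LHS]halfD -[RHS]halfD; congr (_ * _).
have -> : Bop bU + Bop bU = A + (Bop bU + Bop bV) by rewrite AUV; bop_abel norm_inner.
by rewrite UVST AST; bop_abel norm_inner.
Qed.

Lemma orth_projectionE E : orth_projection dot E <-> E^h = E /\ E * E = E.
Proof.
split=> [[/self_adjointE Eh EE]|[Eh EE]]; first by split=> //; exact: bop_fun_inj.
by split; [exact/self_adjointE|rewrite -[in RHS]EE].
Qed.

Lemma range_idem E f : E * E = E -> range E f <-> E f = f.
Proof. by move=> EE; split=> [[g _ <-]|<-]; [rewrite -bopM EE|exists f]. Qed.

Lemma proj_onE E : E^h = E -> E * E = E -> proj_on dot (range E) = E.
Proof.
move=> Eh EE; apply: xget_unique => [|Q [Qp rQ]].
  by split=> //; exact/orth_projectionE.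
have [[bQ _] _] := Qp.
have /orth_projectionE[Qh QQ] : orth_projection dot (Bop bQ) by [].
suff E' : Bop bQ = E by rewrite -E'.
have EQ : E * Bop bQ = Bop bQ.
  by apply: bop_inj => f; rewrite bopM; apply/(range_idem _ EE); rewrite -rQ; exists f.
have QE : Bop bQ * E = E.
  apply: bop_inj => f; rewrite bopM; apply/(range_idem _ QQ).
  by rewrite [range _]rQ; exists f.
by rewrite -Qh -EQ adjM// Qh Eh QE.
Qed.

Lemma orth_range E f : E^h = E -> orth dot (range E) f <-> E f = 0.
Proof.
move=> Eh; split=> [fE|Ef0 _ [g _ <-]].
  apply: (rip_inj norm_inner) => g; rewrite -[in LHS]Eh adjP// ripC.
  by rewrite [RHS]ripC rip0r /rip fE//; exists g.
have [_ ->] := (self_adjointE E).2 Eh.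
by rewrite Ef0 /inner linear0l.
Qed.

Lemma inv_onE E S T : E^h = E -> E * E = E ->
  E * S = S -> S * E = S -> S * T * E = E -> T * S = E -> inv_on dot (range E) T = S.
Proof.
move=> Eh EE ES SE STE TS; apply: xget_unique => [|S' [bS' S'E S'0]].
  split; first exact: bopP.
    move=> f /(range_idem _ EE) Ef; split.
    - by apply/(range_idem _ EE); rewrite -bopM ES.
    - by rewrite -{1}Ef -[LHS]/((S * T * E) f) STE.
    - by rewrite -bopM TS.
  by move=> g /(orth_range _ Eh) Eg0; rewrite -SE bopM Eg0 linear0.
apply/funext => f; have := linearD (Bop bS') (E f) (f - E f).
rewrite [E f + _]addrC subrK /= => ->.
rewrite (S'0 (f - E f)) ?addr0; last first.
  by apply/(orth_range _ Eh); rewrite linearB/= -[E (E f)]/((E * E) f) EE subrr.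
have [|_ _ TS'] := S'E (E f); first by exists f.
have [|ES' _ _] := S'E (E f); first by exists f.
move/(range_idem _ EE): ES' => ES'.
have : S (T (E (S' (E f)))) = E (S' (E f)) by rewrite -[LHS]/((S * T * E) (S' (E f))) STE.
by rewrite ES' TS' -[S (E f)]/((S * E) f) SE => ->.
Qed.

Lemma dim_set0 : dim_set [set 0 : K] = 0%E.
Proof.
apply/eqP; rewrite eq_le; apply/andP; split.
  apply: ge_ereal_sup => _ [n [e [eM eI ->]]].
  case: n e eM eI => // n e eM eI; exfalso.
  have sum0 : \sum_(i < n.+1) (1 : R[i]) *: e i = 0.
    by rewrite big1// => i _; rewrite eM scaler0.
  by have /eqP := eI (fun=> 1) sum0 ord0; rewrite oner_eq0.
apply: ereal_sup_ubound; exists 0%N, (fun=> 0); split=> //.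
by move=> c _ [].
Qed.

Lemma dim_set_eq0 (M : set K) : dim_set M = 0%E -> M `<=` [set 0].
Proof.
move=> dim0 f Mf; apply/eqP/negP => /negP f0.
have : (1%:E <= dim_set M)%E; last by rewrite dim0 lee_fin ler10.
apply: ereal_sup_ubound; exists 1%N, (fun=> f); split=> // c.
rewrite big_ord1 => /eqP; rewrite scaler_eq0 (negbTE f0) orbF => /eqP c0 i.
by rewrite ord1.
Qed.

(** Needed for the index of [W]: since [dagb W = dagb V * U], its kernel is the preimage of the
    kernel of [dagb V] under the invertible [U]. *)
Lemma dim_set_preimage A B (M : set K) : A * B = 1 -> B * A = 1 ->
  dim_set (A @^-1` M) = dim_set M.
Proof.
have le (C D : bop K) (N : set K) : C * D = 1 -> D * C = 1 -> (dim_set (C @^-1` N) <= dim_set N)%E.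
  move=> CD DC; apply: ge_ereal_sup => _ [n [e [eN eI ->]]].
  apply: ereal_sup_ubound; exists n, (fun i => C (e i)); split=> // c c0.
  apply: eI; rewrite -[LHS]/((1 : bop K) _) -DC bopM linear_sum.
  under eq_bigr do rewrite linearZ.
  by rewrite /= c0 linear0.
move=> AB BA; apply/eqP; rewrite eq_le (le A B)//=.
have AK : cancel B A by move=> f; rewrite -[LHS]/((A * B) f) AB.
have {1}-> : M = B @^-1` (A @^-1` M).
  by apply/funext => f; rewrite /preimage/= AK.
exact: (le B A).
Qed.

End Bridge.

(** * Conjugation of bounded operators *)

Section Conjugation.
Context (R : realType) (K : completeNormedModType R[i]).
Context (dot : {dot K for Num.conj}).
Context (norm_inner : forall f : K, `|f| ^+ 2 = inner dot f f).
Context (star : K -> K) (starP : conjugation dot star).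
Implicit Types (A B E S T : bop K) (f g : K).
Local Notation ip := (rip dot).
Local Notation pos := (pos dot).
Local Notation "A ^h" := (adjb dot A) : ring_scope.

Lemma starK : involutive star. Proof. by case: starP. Qed.

Lemma starD : {morph star : f g / f + g}.
Proof.
case: starP => sP _ _ f g; have := sP 1 f g.
by rewrite rmorph1 !scale1r.
Qed.

Lemma star0 : star 0 = 0.
Proof. by apply: (addrI (star 0)); rewrite -starD !addr0. Qed.

Lemma starZ (a : R[i]) f : star (a *: f) = Num.conj a *: star f.
Proof. by case: starP => sP _ _; rewrite -[a *: f]addr0 sP star0 addr0. Qed.

Lemma inner_star f g : inner dot (star f) (star g) = Num.conj (inner dot f g).
Proof. by case: starP. Qed.

Lemma rip_star f g : ip (star f) (star g) = ip f g.
Proof. by rewrite /rip inner_star ReconjC. Qed.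

Lemma rnorm_star f : rnorm (star f) = rnorm f.
Proof. by apply/eqP; rewrite -(@eqrXn2 _ 2) ?rnorm_ge0// !(rnorm_sqr norm_inner) rip_star. Qed.

Lemma bounded_bar A : bounded_op (bar star A).
Proof.
apply/bounded_opP.
  by move=> a f g; rewrite /bar /= starD starZ linearD linearZ starD starZ conjCK.
have [a a0 Aa] := bop_bound A; exists a => // f.
by rewrite /bar /= rnorm_star -(rnorm_star f).
Qed.

Definition barb A : bop K := Bop (bounded_bar A).

Lemma barE A f : barb A f = star (A (star f)). Proof. by []. Qed.

Lemma barM A B : barb (A * B) = barb A * barb B.
Proof. by apply: bop_inj => f; rewrite bopM !barE starK. Qed.

Lemma barD A B : barb (A + B) = barb A + barb B.
Proof. by apply: bop_inj => f; rewrite bopD !barE starD. Qed.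

Lemma bar1 : barb 1 = 1.
Proof. by apply: bop_inj => f; rewrite barE starK. Qed.

Lemma bar0 : barb 0 = 0.
Proof. by apply: bop_inj => f; rewrite barE /= star0. Qed.

Lemma barN A : barb (- A) = - barb A.
Proof. by apply: (addrI (barb A)); rewrite -barD !subrr bar0. Qed.

Lemma barB A B : barb (A - B) = barb A - barb B.
Proof. by rewrite barD barN. Qed.

Lemma bar_half : barb (half K) = half K.
Proof.
apply: bop_inj => f; rewrite barE /= starZ starK; congr (_ *: _).
by apply/eqP; rewrite eq_complex/= oppr0 !eqxx.
Qed.

Lemma bar_adj A : barb A^h = (barb A)^h.
Proof.
apply/esym/(adj_unique norm_inner) => f g.
by rewrite !barE -[g in LHS]starK rip_star adjP// -[in RHS](starK f) rip_star.
Qed.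

Lemma bar_pos A : pos A -> pos (barb A).
Proof.
move=> [Ah A0]; split=> [|f]; first by rewrite -bar_adj Ah.
by rewrite barE -[X in ip X]starK rip_star.
Qed.

Lemma star_basis e : orthonormal_basis dot e -> orthonormal_basis dot (star \o e).
Proof.
move=> [e_on e_total]; split=> [i j|f f0].
  by rewrite inner_star e_on; case: eqP => _; rewrite ?rmorph1 ?rmorph0.
rewrite -[f]starK (e_total (star f)) ?star0// => i.
by rewrite -[e i]starK inner_star (f0 i) rmorph0.
Qed.

Lemma hs_bar e A : orthonormal_basis dot e -> hs e A -> hs e (barb A).
Proof.
move=> e_b [c Ac]; apply: (hs_basis norm_inner (star_basis e_b) e_b).
by exists c => n; under eq_bigr do rewrite barE /= starK rnorm_star.
Qed.

(** [barb S] is again a positive root of the same operator, and such a root is unique. *)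
Lemma bar_sqrt_eq S : pos S -> barb (S * S) = S * S -> barb S = S.
Proof.
move=> posS SS; apply: bop_fun_inj.
rewrite -(sqrt_opE norm_inner posS (erefl _)).
by apply/esym/(sqrt_opE norm_inner (bar_pos posS)); rewrite -barM.
Qed.

End Conjugation.

Lemma inverse_commute (A : pzRingType) (T S Y : A) :
  T * S = 1 -> S * T = 1 -> T * Y = Y * T -> S * Y = Y * S.
Proof.
move=> TS ST TY; rewrite -[LHS]mulr1 -TS mulrA -(mulrA S Y) -TY.
by rewrite [S * _]mulrA ST mul1r.
Qed.

(** Lets a relation between two factors rewrite inside a left-associated word, where the product
    [X * Y] is not a subterm. *)
Lemma mulr_eqr (A : pzRingType) (X Y Z : A) : X * Y = Z -> forall W, W * X * Y = W * Z.
Proof. by move=> <- W; rewrite mulrA. Qed.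

(** * The indefinite form and the decomposition *)

Section IndefiniteSplitting.
Context (R : realType) (K : completeNormedModType R[i]).
Context (dot : {dot K for Num.conj}).
Context (norm_inner : forall f : K, `|f| ^+ 2 = inner dot f f).
Context (star : K -> K) (starP : conjugation dot star).
Implicit Types (A B E S T : bop K) (f g : K).
Local Notation pos := (pos dot).
Local Notation "A ^h" := (adjb dot A) : ring_scope.
Local Notation bar := (barb norm_inner starP).

(* [Q] and [C] are variables with defining equations because rewriting patterns such
   as [_ - _] would unfold definitions. *)
Context (P Q C : bop K) (Ph : P^h = P) (PP : P * P = P) (barP : bar P = 1 - P).
Context (QE : Q = 1 - P) (CE : C = P - Q).

Definition dagb A : bop K := C * A^h * C.

Let PPr := mulr_eqr PP.

Lemma compl_adj : Q^h = Q.
Proof. by rewrite QE adjB// adj1// Ph. Qed.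

Lemma compl_idem : Q * Q = Q.
Proof. by rewrite QE !(mulrBl, mulrBr, mul1r, mulr1) PP; bop_abel norm_inner. Qed.

Lemma mulPQ : P * Q = 0. Proof. by rewrite QE mulrBr mulr1 PP subrr. Qed.

Lemma mulQP : Q * P = 0. Proof. by rewrite QE mulrBl mul1r PP subrr. Qed.

Lemma addPQ : P + Q = 1. Proof. by rewrite QE addrC subrK. Qed.

Lemma bar_compl : bar Q = P. Proof. by rewrite QE barB bar1 barP subKr. Qed.

Lemma bar_proj : bar P = Q. Proof. by rewrite QE. Qed.

Lemma sgnb_adj : C^h = C. Proof. by rewrite CE adjB// Ph compl_adj. Qed.

Lemma mulPC : P * C = P. Proof. by rewrite CE mulrBr PP mulPQ subr0. Qed.

Lemma mulCP : C * P = P. Proof. by rewrite CE mulrBl PP mulQP subr0. Qed.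

Lemma mulQC : Q * C = - Q. Proof. by rewrite CE mulrBr mulQP compl_idem sub0r. Qed.

Lemma mulCQ : C * Q = - Q. Proof. by rewrite CE mulrBl mulPQ compl_idem sub0r. Qed.

Lemma sgnb_sqr : C * C = 1.
Proof. by rewrite {1}CE mulrBl mulPC mulQC opprK addPQ. Qed.

Lemma mul_sgnb_sqr A : A * C * C = A.
Proof. by rewrite -mulrA sgnb_sqr mulr1. Qed.

Lemma bar_sgnb : bar C = - C.
Proof. by rewrite CE barB bar_proj bar_compl opprB. Qed.

Lemma sgnbE : C = P + P - 1.
Proof. by rewrite CE QE; bop_abel norm_inner. Qed.

Lemma compl_comm A : A * P = P * A -> A * Q = Q * A.
Proof. by move=> AP; rewrite QE mulrBl mulrBr mul1r mulr1 AP. Qed.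

Lemma sgnb_comm A : A * P = P * A -> A * C = C * A.
Proof. by move=> AP; rewrite CE mulrBl mulrBr AP compl_comm. Qed.

Lemma dagbK A : dagb (dagb A) = A.
Proof. by rewrite /dagb !adjM// adjK// sgnb_adj !mulrA sgnb_sqr mul1r mul_sgnb_sqr. Qed.

Lemma dagbM A B : dagb (A * B) = dagb B * dagb A.
Proof. by rewrite /dagb adjM// !mulrA mul_sgnb_sqr. Qed.

Lemma bar_dagb A : bar (dagb A) = dagb (bar A).
Proof. by rewrite /dagb !barM bar_adj bar_sgnb !(mulNr, mulrN) opprK. Qed.

Lemma pos_idem E : E^h = E -> E * E = E -> pos E.
Proof. by move=> Eh EE; rewrite -EE -{1}Eh; exact: pos_sqr. Qed.

Let QQr := mulr_eqr compl_idem.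
Let CPr := mulr_eqr mulCP.
Let CQr := mulr_eqr mulCQ.

Lemma CopE : Cop P = C. Proof. by rewrite CE QE. Qed.

Lemma dagE A : dag dot P A = dagb A.
Proof. by rewrite /dag adjE// CopE. Qed.

Lemma P2E : P2 P = Q. Proof. by rewrite QE. Qed.

(** [rho] is [M^(-1/2)]. It is exported because [P X P = M P] and [Q X Q = M Q] make it invert the
    diagonal blocks of [U], as the polar decompositions of the blocks of [V] require. *)
Lemma conjugating_operator p : p * p = p -> pos (p * C) -> bar p = 1 - p ->
  exists U rho : bop K,
  [/\ [/\ pos U, U * dagb U = 1, dagb U * U = 1 & bar U = U],
      U * P * dagb U = p,
      UZ dot P (b21 P p \o inv_on dot (range P) (b11 P p)) = U,
      [/\ rho * P = P * rho, rho^h = rho, P * U * P * rho = P & Q * U * Q * rho = Q] &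
      forall e, orthonormal_basis dot e -> hs e (p * C - C * p) -> hs e (U - 1)].
Proof.
move=> pp posG barp.
have ppr := mulr_eqr pp.
(* [X] and its conjugate [C X C] commute and have the product [M >= 1], so that
   [U := X M^(-1/2)] satisfies [U (C U^* C) = 1]. *)
have [X XE] : exists X, X = p * C + Q by eexists.
(* This is [P p P + Q (1 - p) Q] with [Q = 1 - P] multiplied out. *)
have [M ME] : exists M, M = p * P + P * p - p + Q by eexists.
have CXC : C * X * C = C * p + Q.
  by rewrite XE mulrDr mulrDl mulrA mul_sgnb_sqr mulCQ mulNr mulQC opprK.
have XXc : X * (C * X * C) = M.
  rewrite CXC XE !(mulrDl, mulrDr) !mulrA mul_sgnb_sqr pp CQr mulQC compl_idem.
  by rewrite ME QE; bop_ring norm_inner.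
have XcX : C * X * C * X = M.
  rewrite CXC XE !(mulrDl, mulrDr) !mulrA compl_idem ppr.
  by rewrite ME sgnbE QE; bop_ring norm_inner.
have MP : M * P = P * p * P.
  by rewrite ME !(mulrDl, mulNr) PPr mulQP; bop_abel norm_inner.
have PM : P * M = P * p * P.
  by rewrite ME !(mulrDr, mulrN) !mulrA PP mulPQ; bop_abel norm_inner.
have Xh : X^h = X by rewrite XE adjD// (pos_adj posG) compl_adj.
have posQ : pos Q by exact: pos_idem compl_adj compl_idem.
have posX : pos X by rewrite XE; exact: posD.
have XM : X * M = M * X by rewrite -{1}XcX !mulrA -XXc !mulrA.
have Mh : M^h = M by rewrite -{1}XXc !adjM// Xh sgnb_adj !mulrA XcX.
have posM1 : pos (M - 1).
  (* With [p C] also [bar (p C) = p C - C] is positive. Compressed to the range of [P] it gives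
     [P p P - P >= 0]; compressing [p C] to the range of [Q] gives [- Q p Q >= 0]. *)
  have -> : M - 1 = P^h * bar (p * C) * P + Q^h * (p * C) * Q.
    rewrite barM barp bar_sgnb Ph compl_adj mulrN mulrBl mul1r opprB mulrBr mulrBl.
    rewrite !mulrA !CPr CQr PP ME QE.
    bop_ring norm_inner.
  by apply: posD => //; apply: pos_congr => //; exact: bar_pos.
have [m [Mm mM mh]] := pos_inverse norm_inner posM1.
have posM : pos M by rewrite -[M](subrK 1); apply: posD => //; exact: pos1.
have posm : pos m.
  have -> : m = m^h * M * m by rewrite mh mM mul1r.
  exact: pos_congr.
have [rho [posr rr rC]] := sqrt_exists norm_inner posm.
have commM Y : M * Y = Y * M -> rho * Y = Y * rho.
  by move=> MY; apply: rC; exact: inverse_commute MY.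
have rX := commM X (esym XM); have rM := commM M (erefl _).
have rP : rho * P = P * rho by apply: commM; rewrite MP.
have rQ := compl_comm rP; have rCm := sgnb_comm rP.
have mP : m * P = P * m by apply: inverse_commute Mm mM _; rewrite MP.
have mQ := compl_comm mP.
have [Xc XcE] : exists Xc, Xc = C * X * C by eexists.
have {}XXc : X * Xc = M by rewrite XcE.
have {}XcX : Xc * X = M by rewrite XcE.
have rXc : rho * Xc = Xc * rho.
  by rewrite XcE !mulrA rCm -(mulrA C) rX !mulrA -(mulrA _ rho) rCm !mulrA.
have [U UE] : exists U, U = X * rho by eexists.
have Uh : U^h = U by rewrite UE adjM// Xh (pos_adj posr) rX.
have dU : dagb U = Xc * rho.
  by rewrite /dagb Uh UE XcE !mulrA -(mulrA _ rho) rCm !mulrA.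
have Mrr : M * rho * rho = 1 by rewrite -mulrA rr.
have UdU : U * dagb U = 1.
  by rewrite dU UE -mulrA (mulrA rho) rXc !mulrA XXc.
have dUU : dagb U * U = 1.
  by rewrite dU UE -mulrA (mulrA rho) rX !mulrA XcX.
have CQP : C + Q = P by rewrite CE subrK.
have XP : X * P = p * P by rewrite XE mulrDl -mulrA mulCP mulQP addr0.
have pX : p * X = X * P by rewrite XP XE mulrDr mulrA pp -mulrDr CQP.
have posU : pos U.
  (* A product of commuting positive operators is positive: [X rho = tau X tau] with [tau] the root
     of [rho]. *)
  have [tau [post tt tC]] := sqrt_exists norm_inner posr.
  have -> : U = tau^h * X * tau; last exact: pos_congr.
  by rewrite (pos_adj post) (tC X rX) -mulrA tt UE.
have barX : bar X = X.
  rewrite XE barD barM barp bar_sgnb bar_compl mulrN mulrBl mul1r opprB -{1}CQP.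
  by bop_abel norm_inner.
have bM : bar M = M.
  by rewrite -XXc XcE !barM barX bar_sgnb !(mulNr, mulrN) opprK.
have bm : bar m = m.
  by rewrite -[bar m]mulr1 -Mm mulrA -{1}bM -barM mM bar1 mul1r.
have br : bar rho = rho by apply: bar_sqrt_eq => //; rewrite rr.
have rPr : rho * P * rho = m * P by rewrite -mulrA -rP mulrA rr.
exists U, rho; split.
- by split=> //; rewrite UE barM barX br.
- by rewrite dU UE -!mulrA (mulrA rho) rP -!mulrA (mulrA rho) rXc !mulrA -pX -(mulrA p) XXc -!mulrA (mulrA M) Mrr mulr1.
(* [sg] is [M^(1/2)], the inverse of [rho]. Both [P + Z^d Z = m P] and [Q + Z Z^d = m Q] hold, so
   the roots in [UZ] are [rho P] and [rho Q], with inverses [sg P] and [sg Q] on the respective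
   ranges. *)
- have [sg sgE] : exists sg, sg = rho * M by eexists.
  have rsg : rho * sg = 1 by rewrite sgE mulrA rr mM.
  have sgr : sg * rho = 1 by rewrite sgE -mulrA -rM mulrA rr mM.
  have msg : m * sg = rho by rewrite -rr -mulrA rsg mulr1.
  have MPc : M * P = P * M by rewrite MP.
  have sP : sg * P = P * sg by rewrite sgE -mulrA MPc mulrA rP mulrA.
  have sQ := compl_comm sP.
  have PmP : P * (m * P) = m * P by rewrite mulrA -mP -mulrA PP.
  have PrP : P * (rho * P) = rho * P by rewrite mulrA -rP -mulrA PP.
  have QrQ : Q * (rho * Q) = rho * Q by rewrite mulrA -rQ -mulrA compl_idem.
  have PsP : P * (sg * P) = sg * P by rewrite mulrA -sP -mulrA PP.
  have QsQ : Q * (sg * Q) = sg * Q by rewrite mulrA -sQ -mulrA compl_idem.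
  have posr_idem E : E^h = E -> E * E = E -> rho * E = E * rho -> pos (rho * E).
    move=> Eh EE rE; have -> : rho * E = E^h * rho * E.
      by rewrite Eh -rE -mulrA EE.
    exact: pos_congr.
  have inv11 : inv_on dot (range P) (b11 P p) = m * P.
    apply: (inv_onE norm_inner (T := P * p * P)) => //.
    - by rewrite -MP !mulrA -(mulrA m) -MPc mulrA mM mul1r !PP.
    - by rewrite -MP -mulrA PmP mulrA Mm mul1r.
  have [Z ZE] : exists Z, Z = Q * p * P * (m * P) by eexists.
  have -> : b21 P p \o inv_on dot (range P) (b11 P p) = Z.
    by rewrite inv11 ZE /b21 P2E.
  have PZ : P + Z = X * (m * P).
    rewrite -PmP mulrA XP -[p in RHS]mul1r -addPQ !mulrDl -ZE -MP.
    by rewrite -(mulrA M) PmP mulrA Mm mul1r.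
  have dZ : dagb Z = P * m * X * C - P.
    have -> : Z = X * (m * P) - P by rewrite -PZ addrC addKr.
    rewrite /dagb adjB// !adjM// Ph mh Xh mulrBr mulrBl mulCP mulPC; congr (_ - _).
    by rewrite !mulrA mulCP.
  have mp : m * p = p * m.
    apply: inverse_commute Mm mM _; rewrite ME QE.
    rewrite !(mulrDl, mulrDr, mulNr, mulrN, mul1r, mulr1) !mulrA !ppr !pp.
    bop_abel norm_inner.
  have mMr : forall W, W * M * m = W by move=> W; rewrite -mulrA Mm mulr1.
  have {}dZ : dagb Z = P * p * m - P.
    rewrite dZ XE mulrDr -!(mulrA P) mQ (mulrA P Q) mulPQ mul0r addr0.
    by rewrite !mulrA mul_sgnb_sqr -(mulrA P) mp mulrA.
  have ZX : Z = p * P * m - P.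
    by rewrite -XP -mulrA -mP -PZ addrC addKr.
  have mPr := fun W => etrans (mulr_eqr mP W) (mulrA W P m).
  have mpr := fun W => etrans (mulr_eqr mp W) (mulrA W p m).
  have dZZ : P + dagb Z * Z = m * P.
    rewrite dZ ZX mulrBr !mulrBl !mulrA !(mpr, mPr) !(ppr, PPr, PP) -MP MPc !mMr mP.
    bop_abel norm_inner.
  have ZdZ : Q + Z * dagb Z = m * Q.
    have pPp : p * P * p = p * M.
      by rewrite ME QE !(mulrDr, mulrN) mulr1 !mulrA pp; bop_abel norm_inner.
    have Qm : Q * m = P + Q - p * P * m - P * p * m + p * m.
      by rewrite addPQ -Mm ME !(mulrDl, mulNr); bop_abel norm_inner.
    rewrite dZ ZX mulrBr !mulrBl !mulrA !(mpr, mPr) !(ppr, PPr, PP) pPp !mMr mQ Qm.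
    bop_abel norm_inner.
  have QdZ : Q - dagb Z = X * (m * Q).
    rewrite dZ XE mQ mulrA mulrDl CQr compl_idem.
    have <- : M - P * p = p * - Q + Q by rewrite ME QE; bop_ring norm_inner.
    rewrite mulrBl Mm -addPQ; bop_abel norm_inner.
  have sq1 : sqrt_op dot (P \+ (dag dot P Z \o Z)) = rho * P.
    rewrite dagE; have -> : P \+ (dagb Z \o Z) = m * P by rewrite -dZZ.
    apply: sqrt_opE => //; first by apply: posr_idem.
    by rewrite -mulrA PrP mulrA rr.
  have sq2 : sqrt_op dot (Q \+ (Z \o dag dot P Z)) = rho * Q.
    rewrite dagE; have -> : Q \+ (Z \o dagb Z) = m * Q by rewrite -ZdZ.
    apply: sqrt_opE => //; first by apply: posr_idem; rewrite ?compl_adj ?compl_idem.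
    by rewrite -mulrA QrQ mulrA rr.
  have invE E : E^h = E -> E * E = E -> sg * E = E * sg -> rho * E = E * rho ->
      inv_on dot (range E) (rho * E) = sg * E.
    move=> Eh EE sE rE; apply: (inv_onE norm_inner) => //.
    - by rewrite mulrA -sE -mulrA EE.
    - by rewrite -mulrA EE.
    - by rewrite !mulrA -(mulrA sg) -rE mulrA sgr mul1r !EE.
    - by rewrite !mulrA -(mulrA rho) -sE mulrA rsg mul1r EE.
  rewrite /UZ P2E sq1 sq2 (invE P)// (invE Q) ?compl_adj ?compl_idem// dagE.
  suff -> : U = (P + Z) * (sg * P) + (Q - dagb Z) * (sg * Q) by [].
  rewrite PZ QdZ -!mulrA PsP QsQ !mulrA -(mulrA X m) -!(mulrA X) msg.
  by rewrite -mulrDr -mulrDr addPQ mulr1.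
- have MPc : M * P = P * M by rewrite MP.
  split=> //; first exact: pos_adj.
    rewrite UE !mulrA -(mulrA _ rho) rP !mulrA -(mulrA P) XP mulrA -PM.
    by rewrite -!mulrA (mulrA M) Mrr mulr1.
  have QXQ : Q * X * Q = M * Q.
    rewrite XE ME mulrDr mulrDl !mulrA !CQr !compl_idem !(mulrDl, mulNr) -(mulrA p) mulPQ.
    have -> : P = 1 - Q by rewrite QE subKr.
    by rewrite compl_idem; bop_ring norm_inner.
  rewrite UE !mulrA -(mulrA _ rho) rQ !mulrA QXQ (compl_comm MPc).
  by rewrite -!mulrA (mulrA M) Mrr mulr1.
- move=> e e_b hsp.
  have [Y [UY YU _]] : exists Y, [/\ (U + 1) * Y = 1, Y * (U + 1) = 1 & Y^h = Y].
    by apply: pos_inverse => //; rewrite addrK.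
  have -> : U - 1 = Y * (U * ((p * C - C * p) * rho)).
    have XXc' : X - Xc = p * C - C * p.
      by rewrite XcE XE mulrDr mulrDl mulrA mul_sgnb_sqr mulCQ mulNr mulQC; bop_abel norm_inner.
    rewrite -XXc' mulrBl -UE -dU mulrBr UdU.
    have -> : U * U - 1 = (U + 1) * (U - 1) by bop_ring norm_inner.
    by rewrite mulrA YU mul1r.
  exact/hsMl/hsMl/hsMr.
Qed.

(** Conjugation exchanges [P] and [Q], so for [V] with [bar V = V] the assumption on one
    off-diagonal block controls the other. *)
Lemma hs_bar_offdiag e A : orthonormal_basis dot e -> hs e (P * A * Q) ->
  hs e (Q * bar A * P).
Proof. by move=> e_b /(hs_bar norm_inner starP e_b); rewrite !barM bar_proj bar_compl. Qed.

(** * Operators whose commutator with [C] is Hilbert-Schmidt *)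

Section AlmostDiagonal.
Context (e : nat -> K) (e_b : orthonormal_basis dot e).

Definition almost_diag A := hs e (A * C - C * A).

Lemma hs_almost_diag A : hs e A -> almost_diag A.
Proof. by move=> Ae; apply: hsB => //; [exact: hsMr|exact: hsMl]. Qed.

Lemma almost_diagD A B : almost_diag A -> almost_diag B -> almost_diag (A + B).
Proof.
move=> Ae Be; rewrite /almost_diag.
have -> : (A + B) * C - C * (A + B) = (A * C - C * A) + (B * C - C * B).
  bop_ring norm_inner.
exact: hsD.
Qed.

Lemma almost_diagN A : almost_diag A -> almost_diag (- A).
Proof.
move=> Ae; rewrite /almost_diag mulNr mulrN -opprD; exact: hsN.
Qed.

Lemma almost_diagM A B : almost_diag A -> almost_diag B -> almost_diag (A * B).
Proof.
move=> Ae Be; rewrite /almost_diag.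
have -> : A * B * C - C * (A * B) = A * (B * C - C * B) + (A * C - C * A) * B.
  bop_ring norm_inner.
by apply: hsD => //; [exact: hsMl|exact: hsMr].
Qed.

Lemma almost_diag_adj A : almost_diag A -> almost_diag A^h.
Proof.
move=> /(hs_adj norm_inner e_b e_b) Ae; rewrite /almost_diag.
have -> : A^h * C - C * A^h = - (A * C - C * A)^h.
  by rewrite adjB// !adjM// sgnb_adj opprB.
exact: hsN.
Qed.

Lemma almost_diag_comm A : A * C = C * A -> almost_diag A.
Proof. by rewrite /almost_diag => ->; rewrite subrr; exists 0 => n; under eq_bigr do rewrite bop0 rnorm0 expr0n; rewrite big1. Qed.

Lemma almost_diag_inverse A B : A * B = 1 -> B * A = 1 -> almost_diag A -> almost_diag B.
Proof.
move=> AB BA Ae; rewrite /almost_diag.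
have -> : B * C - C * B = - (B * (A * C - C * A) * B).
  rewrite mulrBr mulrBl !mulrA BA mul1r -!mulrA AB mulr1; bop_abel norm_inner.
exact/hsN/hsMr/hsMl.
Qed.

Lemma almost_diag_offdiag A : hs e (P * A * Q) -> hs e (Q * A * P) -> almost_diag A.
Proof.
move=> A12 A21; rewrite /almost_diag.
have -> : A * C - C * A = (Q * A * P - P * A * Q) + (Q * A * P - P * A * Q).
  rewrite CE QE; bop_ring norm_inner.
by apply: hsD => //; exact: hsB.
Qed.

End AlmostDiagonal.

Lemma bar_inverse A B : A * B = 1 -> B * A = 1 -> bar A = A -> bar B = B.
Proof.
move=> AB BA Ab.
by rewrite -[LHS]mulr1 -AB mulrA -{1}Ab -barM BA bar1 mul1r.
Qed.

(** The two summands of [P_V] annihilate each other, because [W E = 0] and [E C V = 0]. Conjugation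
    turns [A] into [- A] and so exchanges its spectral parts; with [1 = V W + B C] this yields
    [bar p = 1 - p]. *)
Lemma PV_spec V : bar V = V -> dagb V * V = 1 ->
  exists p : bop K,
  [/\ PV dot P V = p, p * p = p /\ pos (p * C), bar p = 1 - p, p * V = V * P &
    forall e, orthonormal_basis dot e -> hs e (P * V * Q) -> hs e (p * C - C * p)].
Proof.
move=> Vb VV.
have [W WE] : exists W, W = dagb V by eexists.
rewrite -WE in VV; have VVr := mulr_eqr VV.
have Wb : bar W = W by rewrite WE bar_dagb Vb.
have CVh : V^h * C = C * W.
  by rewrite WE /dagb !mulrA sgnb_sqr mul1r.
have WC : W * C = C * V^h by rewrite WE /dagb mul_sgnb_sqr.
have [r rE] : exists r, r = 1 - V * W by eexists.
have rr : r * r = r.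
  by rewrite {1}rE mulrBl mul1r rE mulrBr mulr1 -!mulrA (mulrA W) VV mul1r subrr subr0.
have Wr : W * r = 0 by rewrite rE mulrBr mulr1 mulrA VV mul1r subrr.
have rh : r^h = C * r * C.
  rewrite rE adjB// adj1// adjM// mulrBr mulr1 mulrBl sgnb_sqr; congr (_ - _).
  have -> : W^h = C * V * C by rewrite WE /dagb !adjM// adjK// sgnb_adj mulrA.
  have -> : V^h = C * W * C by rewrite -mulrA WC mulrA sgnb_sqr mul1r.
  by rewrite !mulrA mul_sgnb_sqr.
have rrhh : r^h * r^h = r^h by rewrite -adjM// rr.
(* [r] is the oblique projection onto the kernel of [W] along the range of [V]; the
   orthogonal projection with the same range is [E = r (r + r^* - 1)^-1], because
   [(r + r^* - 1)^2 = 1 + (r - r^* )(r - r^* )^*]. *)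
have [q0 q0E] : exists q0, q0 = r + r^h - 1 by eexists.
have q0h : q0^h = q0 by rewrite q0E adjB// adjD// adjK// adj1// (addrC r).
have [q [Qq qQ qh]] : exists q, [/\ q0 * q0 * q = 1, q * (q0 * q0) = 1 & q^h = q].
  apply: pos_inverse => //.
  have -> : q0 * q0 - 1 = (r^h - r)^h * (r^h - r).
    rewrite adjB// adjK// q0E.
    rewrite !(mulrDl, mulrDr, mulrN, mulNr, mul1r, mulr1) rr rrhh; bop_abel norm_inner.
  exact: pos_sqr.
have [L LE] : exists L, L = q0 * q by eexists.
have q0L : q0 * L = 1 by rewrite LE mulrA.
have q0q : q * q0 = q0 * q by apply: inverse_commute Qq qQ _; rewrite mulrA.
have Lq0 : L * q0 = 1 by rewrite LE -mulrA q0q mulrA.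
have Lh : L^h = L by rewrite LE adjM// qh q0h q0q.
have q0r : q0 * r = r^h * q0.
  by rewrite q0E !(mulrDl, mulrDr, mulrN, mulNr, mul1r, mulr1) rr rrhh; bop_abel norm_inner.
have rq0 : r * q0 = q0 * r^h.
  by rewrite q0E !(mulrDl, mulrDr, mulrN, mulNr, mul1r, mulr1) rr rrhh; bop_abel norm_inner.
have rq0' : r * q0 = r * r^h.
  by rewrite q0E !(mulrDr, mulrN, mulr1) rr; bop_abel norm_inner.
have Lrh : L * r^h = r * L.
  by rewrite -[LHS]mulr1 -q0L mulrA -(mulrA L) -q0r mulrA Lq0 mul1r.
have Lr : L * r = r^h * L.
  by rewrite -[LHS]mulr1 -q0L !mulrA -(mulrA L) rq0 mulrA Lq0 mul1r.
have [E Edef] : exists E, E = r * L by eexists.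
have Er : E * r = r by rewrite Edef -mulrA Lr mulrA -rq0' -mulrA q0L mulr1.
have rE' : r * E = E by rewrite Edef mulrA rr.
have EE : E * E = E by rewrite {2}Edef mulrA Er -Edef.
have Eh : E^h = E by rewrite Edef adjM// Lh Lrh.
have WE0 : W * E = 0 by rewrite Edef mulrA Wr mul0r.
have adj0 : 0^h = 0 :> bop K := pos_adj (pos0 norm_inner).
have ECV : E * C * V = 0.
  have -> : E * C * V = (V^h * C * E)^h.
    by rewrite !adjM// adjK// Eh sgnb_adj mulrA.
  by rewrite CVh -mulrA WE0 mulr0.
(* [B] inverts [A = E C E] on the range of [E]. *)
have [A Adef] : exists A, A = E * C * E by eexists.
have [B Bdef] : exists B, B = r * C by eexists.
have Ah : A^h = A by rewrite Adef !adjM// Eh sgnb_adj mulrA.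
have Bh : B^h = B by rewrite Bdef adjM// sgnb_adj rh !mulrA sgnb_sqr mul1r.
have EA : E * A = A by rewrite Adef !mulrA EE.
have AE : A * E = A by rewrite Adef -!mulrA EE.
have EB : E * B = B by rewrite Bdef mulrA Er.
have BE : B * E = B by rewrite -Bh -{1}Eh -adjM// EB.
have AB : A * B = E.
  rewrite Bdef Adef mulrA -(mulrA (E * C)) Er -!mulrA (mulrA C) -rh.
  by rewrite -{1}Eh -adjM// rE' Eh.
have BA : B * A = E by rewrite -Bh -Ah -adjM// AB.
have barW : bar r = r by rewrite rE barB bar1 barM Vb Wb.
have bq0 : bar q0 = q0 by rewrite q0E barB barD bar1 bar_adj barW.
have bq : bar q = q by apply: bar_inverse Qq qQ _; rewrite barM bq0.
have bE : bar E = E by rewrite Edef LE !barM barW bq0 bq.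
have bA : bar A = - A by rewrite Adef !barM bE bar_sgnb mulrN mulNr.
have EEr := mulr_eqr EE; have ABr := mulr_eqr AB; have BAr := mulr_eqr BA.
have AEr := mulr_eqr AE; have BEr := mulr_eqr BE.
(* Extending [A * A] by the identity off the range of [E] makes it invertible on the whole space;
   its root [k] is the absolute value of [A] on that range and 1 on the complement. *)
have [T Tdef] : exists T, T = A * A + 1 - E by eexists.
have [Ti Tidef] : exists Ti, Ti = B * B + 1 - E by eexists.
have TTi : T * Ti = 1.
  rewrite Tdef Tidef !(mulrDl, mulrDr, mulrN, mulNr, mul1r, mulr1) !mulrA.
  by rewrite ABr AEr AE EB EE AB; bop_abel norm_inner.
have TiT : Ti * T = 1.
  rewrite Tdef Tidef !(mulrDl, mulrDr, mulrN, mulNr, mul1r, mulr1) !mulrA.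
  by rewrite BAr BEr BE EA EE BA; bop_abel norm_inner.
have posT : pos T.
  rewrite Tdef -addrA; apply: posD => //; first exact: pos_sqr_sym.
  apply: pos_idem; first by rewrite adjB// adj1// Eh.
  by rewrite !(mulrBl, mulrBr, mul1r, mulr1) EE; bop_abel norm_inner.
have [k [posk kk kC]] := sqrt_exists norm_inner posT.
have TA : T * A = A * T.
  by rewrite Tdef !(mulrDl, mulrDr, mulrN, mulNr, mul1r, mulr1) !mulrA EA AE.
have TE : T * E = E * T.
  by rewrite Tdef !(mulrDl, mulrDr, mulrN, mulNr, mul1r, mulr1) !mulrA EA AEr.
have kA := kC A TA; have kE := kC E TE.
have kTi : k * Ti = Ti * k.
  by apply: kC; rewrite TTi TiT.
have [mu muE] : exists mu, mu = k * Ti by eexists.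
have kmu : k * mu = 1 by rewrite muE mulrA kk.
have muk : mu * k = 1 by rewrite muE kTi -mulrA kk.
have mumu : mu * mu = Ti by rewrite {2}muE mulrA muk mul1r.
have muA : mu * A = A * mu := inverse_commute kmu muk kA.
have muE' : mu * E = E * mu := inverse_commute kmu muk kE.
have Tih : Ti^h = Ti by rewrite Tidef adjB// adjD// adjM// adj1// Bh Eh.
have muh : mu^h = mu by rewrite muE adjM// Tih (pos_adj posk).
have posmu : pos mu.
  have -> : mu = mu^h * k * mu by rewrite muh muk mul1r.
  exact: pos_congr.
have bT : bar T = T by rewrite Tdef barB barD barM bar1 bA bE mulrN mulNr opprK.
have bTi : bar Ti = Ti by apply: bar_inverse TTi TiT bT.
have bk : bar k = k by apply: bar_sqrt_eq => //; rewrite kk.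
have bmu : bar mu = mu by rewrite muE barM bk bTi.
(* [S] is the sign of [A], hence [Ep] and [Em] are its spectral projections. *)
have [S SE] : exists S, S = mu * A by eexists.
have SS : S * S = E.
  rewrite SE {1}muA -mulrA (mulrA mu) mumu Tidef !(mulrDl, mulNr, mul1r).
  by rewrite EA addrK !mulrA AB -mulrA BA EE.
have SEE : S * E = S by rewrite SE -mulrA AE.
have ESE : E * S = S by rewrite SE mulrA -muE' -mulrA EA.
have Sh : S^h = S by rewrite SE adjM// muh Ah -muA.
have bS : bar S = - S by rewrite SE barM bmu bA mulrN.
have kS : k * S = A by rewrite SE mulrA kmu mul1r.
have muS : mu * S = B.
  rewrite SE mulrA mumu Tidef !(mulrDl, mulNr, mul1r) EA addrK -mulrA BA; exact: BE.
have [Ep EpE] : exists Ep, Ep = half K * (E + S) by eexists.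
have [Em EmE] : exists Em, Em = half K * (E - S) by eexists.
have Sk : S * k = A by rewrite SE -mulrA -kA mulrA muk mul1r.
have half_mul X Y : half K * X * (half K * Y) = half K * (half K * (X * Y)).
  by rewrite !mulrA -(mulrA _ X) -halfC !mulrA.
have half_idem X : X * X = X + X -> half K * X * (half K * X) = half K * X.
  by move=> XX; rewrite half_mul XX halfD.
have half_h X : X^h = X -> (half K * X)^h = half K * X.
  by move=> Xh; rewrite adjM// Xh adj_rscale// -halfC.
have EpEp : Ep * Ep = Ep.
  rewrite EpE half_idem// !(mulrDl, mulrDr) EE SS SEE ESE; bop_abel norm_inner.
have EmEm : Em * Em = Em.
  rewrite EmE half_idem// !(mulrBl, mulrBr) EE SS SEE ESE; bop_abel norm_inner.
have EpEm : Ep * Em = 0.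
  rewrite EpE EmE half_mul !(mulrDl, mulrBr) EE SS SEE ESE.
  have -> : E - S + (S - E) = 0 by bop_abel norm_inner.
  by rewrite !mulr0.
have Eph : Ep^h = Ep by rewrite EpE half_h// adjD// Eh Sh.
have Emh : Em^h = Em by rewrite EmE half_h// adjB// Eh Sh.
have EpBEm : Ep - Em = S.
  rewrite EpE EmE -mulrBr.
  have -> : E + S - (E - S) = S + S by bop_abel norm_inner.
  exact: halfD.
have half_comm Y X : Y * X = X * Y -> Y * (half K * X) = half K * X * Y.
  by move=> YX; rewrite mulrA -halfC -!mulrA YX.
have kEp : k * Ep = Ep * k.
  by rewrite EpE half_comm// mulrDr mulrDl kE kS Sk.
have kEm : k * Em = Em * k.
  by rewrite EmE half_comm// mulrBr mulrBl kE kS Sk.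
have muEp : mu * Ep = Ep * mu := inverse_commute kmu muk kEp.
have EEp : E * Ep = Ep by rewrite EpE mulrA -halfC -mulrA mulrDr EE ESE.
have EpE' : Ep * E = Ep by rewrite -Eph -{1}Eh -adjM// EEp.
have SEp : S * Ep = Ep by rewrite EpE mulrA -halfC -mulrA mulrDr SEE SS addrC.
have AEp : A * Ep = k * Ep by rewrite -kS -mulrA SEp.
have pos_comm D F : pos D -> F^h = F -> F * F = F -> D * F = F * D -> pos (D * F).
  move=> posD' Fh FF DF; have -> : D * F = F^h * D * F by rewrite Fh -DF -mulrA FF.
  exact: pos_congr.
have barEp : bar Ep = Em.
  by rewrite EpE EmE barM bar_half barD bE bS.
have kerE : ker (dag dot P V) = range E.
  rewrite dagE -WE; apply/seteqP; split=> [f /= Wf|_ [f _ <-]].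
    exists f => //; have rf : r f = f.
      by rewrite rE -[LHS]/(f - V (W f)) Wf linear0 subr0.
    by rewrite -[in LHS]rf -[LHS]/((E * r) f) Er.
  by rewrite /ker/= -[LHS]/((W * E) f) WE0.
(* On the range of [E] the operator [k] is the absolute value of [A], so the positive and negative
   parts are [k Ep] and [k Em]. *)
have posA_E : pos_part dot (E \o Cop P \o E) = k * Ep.
  rewrite CopE; have -> : E \o C \o E = A by rewrite Adef.
  apply: (@pos_partE _ _ _ norm_inner A (k * Ep) (k * Em)).
  - exact: pos_comm.
  - exact: pos_comm.
  - by rewrite -mulrBr EpBEm kS.
  - by rewrite kEm mulrA -(mulrA k) EpEm mulr0 mul0r.
have rangeAp : range (k * Ep) = range Ep.
  apply/seteqP; split=> _ [f _ <-]; first by rewrite kEp; exists (k f).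
  exists (mu f) => //; rewrite -[LHS]/((k * Ep * mu) f).
  by rewrite -mulrA -muEp mulrA kmu mul1r.
have PVpE : PVplus dot P V = mu * Ep * C.
  rewrite /PVplus kerE (proj_onE norm_inner Eh EE) posA_E rangeAp CopE.
  rewrite (@inv_onE _ _ _ norm_inner Ep (mu * Ep) (k * Ep))//.
  - by rewrite muEp mulrA EpEp.
  - by rewrite -mulrA EpEp.
  - by rewrite muEp !mulrA -(mulrA Ep) muk mulr1 !EpEp.
  - by rewrite kEp !mulrA -(mulrA Ep) kmu mulr1 EpEp.
exists (V * P * W + mu * Ep * C).
have WEp : W * Ep = 0 by rewrite -EEp mulrA WE0 mul0r.
have EpCV : Ep * C * V = 0 by rewrite -EpE' -!mulrA (mulrA E) ECV mulr0.
have BpBm : mu * Ep - mu * Em = B by rewrite -mulrBr EpBEm muS.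
split.
- by rewrite /PV PVpE dagE -WE.
- split.
    have EpCEp : Ep * C * Ep = Ep * k.
      transitivity (Ep * (A * Ep)); last by rewrite AEp kEp mulrA EpEp.
      by rewrite Adef !mulrA EpE' -!mulrA EEp.
    have z1 : V * P * W * (mu * Ep * C) = 0.
      by rewrite muEp !mulrA -(mulrA _ W) WEp mulr0 !mul0r.
    have z2 : mu * Ep * C * (V * P * W) = 0.
      by rewrite !mulrA -(mulrA mu) -(mulrA mu) EpCV mulr0 !mul0r.
    have i1 : V * P * W * (V * P * W) = V * P * W.
      by rewrite !mulrA VVr mulr1 PPr.
    have i2 : mu * Ep * C * (mu * Ep * C) = mu * Ep * C.
      rewrite [in X in _ * X]muEp !mulrA -(mulrA mu) -(mulrA mu) EpCEp -kEp mulrA muk.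
      by rewrite mul1r -muEp !mulrA.
    by rewrite mulrDl !mulrDr z1 z2 i1 i2 addr0 add0r.
  rewrite mulrDl mul_sgnb_sqr; apply: posD => //; last exact: pos_comm.
  (* [W C = C V^h] turns the first summand of [p C] into the positive operator [V P V^h]. *)
  rewrite -mulrA WC mulrA -(mulrA V) mulPC.
  by have := pos_congr norm_inner V^h (pos_idem Ph PP); rewrite adjK.
- rewrite barD !barM bar_proj Vb Wb bmu barEp bar_sgnb.
  have -> : 1 = V * W + B * C by rewrite Bdef mul_sgnb_sqr rE addrC subrK.
  by rewrite -BpBm QE; bop_ring norm_inner.
- by rewrite mulrDl -!(mulrA mu) EpCV mulr0 addr0 -mulrA VV mulr1.
move=> e e_b V12.
have dV : almost_diag e V.
  apply: almost_diag_offdiag => //; rewrite -Vb; exact: hs_bar_offdiag.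
have dP : almost_diag e P by apply: almost_diag_comm; rewrite mulPC mulCP.
have dC : almost_diag e C by exact: almost_diag_comm.
have dW : almost_diag e W.
  rewrite WE; apply: almost_diagM => //; apply: almost_diagM => //.
  exact: almost_diag_adj.
have d1 : almost_diag e 1 by apply: almost_diag_comm; rewrite mul1r mulr1.
have dr : almost_diag e r by rewrite rE; apply: almost_diagD => //; apply: almost_diagN; exact: almost_diagM.
have dq0 : almost_diag e q0.
  by rewrite q0E; apply: almost_diagD; [apply: almost_diagD|apply: almost_diagN];
     [| exact: almost_diag_adj |].
have dq : almost_diag e q by apply: (almost_diag_inverse e_b Qq qQ); exact: almost_diagM.
have dE : almost_diag e E by rewrite Edef LE; do 2!apply: almost_diagM => //.
have k1 : hs e (k - 1).
  have [Y [kY Yk _]] : exists Y, [/\ (k + 1) * Y = 1, Y * (k + 1) = 1 & Y^h = Y].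
    by apply: pos_inverse => //; rewrite addrK.
  have -> : k - 1 = Y * (E * C * (E * C - C * E) * E).
    have -> : E * C * (E * C - C * E) * E = (k + 1) * (k - 1).
      have -> : (k + 1) * (k - 1) = T - 1 by rewrite -kk; bop_ring norm_inner.
      rewrite mulrBr mulrBl Tdef Adef !mulrA mul_sgnb_sqr !EEr !EE.
      bop_abel norm_inner.
    by rewrite mulrA Yk mul1r.
  exact/hsMl/hsMr/hsMl.
have mu1 : hs e (mu - 1).
  have -> : mu - 1 = - (mu * (k - 1)) by rewrite mulrBr muk mulr1 opprB.
  exact/hsN/hsMl.
have dB : almost_diag e B by rewrite Bdef; exact: almost_diagM.
apply: almost_diagD; first by apply: almost_diagM => //; exact: almost_diagM.
apply: almost_diagM => //.
(* [2 mu Ep = mu E + mu S] and [mu S = B], so the claim reduces to [mu - 1], [E] and [B], which are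
   already controlled. *)
have -> : mu * Ep = half K * ((mu - 1) * E + E + B).
  rewrite EpE mulrA -halfC -mulrA mulrDr muS; congr (_ * _); bop_ring norm_inner.
apply: almost_diagM => //; first by apply: almost_diag_comm; exact: halfC.
apply: almost_diagD => //; apply: almost_diagD => //.
by apply/hs_almost_diag/hsMr.
Qed.

(** * Diagonal operators, block polar decompositions and the factorization *)

Lemma S_gammaE A : S_gamma dot star P A <-> bar A = A /\ dagb A * A = 1.
Proof.
split=> [[_ Ab AA]|[Ab AA]].
  by split; apply: bop_fun_inj => //; rewrite -[RHS]/(@idfun K) -AA dagE.
by split; [exact: bopP|rewrite -[in RHS]Ab|rewrite dagE -[RHS]/(bop_fun 1) -AA].
Qed.

(** For diagonal [W] the projection [F = 1 - W W^h] onto the kernel commutes with [C]. The positive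
    part of [F C F] is the projection [F P], which is its own inverse on its range, and
    [W P W^h + F P = P]. *)
Lemma PV_diag W : dagb W * W = 1 -> W * P = P * W -> PV dot P W = P.
Proof.
move=> WW WP; have WC := sgnb_comm WP.
have WhP : W^h * P = P * W^h by rewrite -{1}Ph -adjM// -WP adjM// Ph.
have WhC := sgnb_comm WhP.
have dW : dagb W = W^h by rewrite /dagb -WhC mul_sgnb_sqr.
rewrite dW in WW.
have [F FE] : exists F, F = 1 - W * W^h by eexists.
have Fh : F^h = F by rewrite FE adjB// adj1// adjM// adjK.
have WF : W^h * F = 0 by rewrite FE mulrBr mulr1 mulrA WW mul1r subrr.
have FF : F * F = F by rewrite {1}FE mulrBl mul1r -mulrA WF mulr0 subr0.
have FP : F * P = P * F.
  by rewrite FE mulrBl mulrBr mul1r mulr1 -mulrA WhP !mulrA WP.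
have FQ := compl_comm FP; have FC := sgnb_comm FP.
have kerF : ker (dag dot P W) = range F.
  rewrite dagE dW; apply/seteqP; split=> [f /= Wf|_ [f _ <-]].
    by exists f => //; rewrite FE -[LHS]/(f - W (W^h f)) Wf linear0 subr0.
  by rewrite /ker/= -[LHS]/((W^h * F) f) WF.
have idem D : D * D = D -> F * D = D * F -> F * D * (F * D) = F * D.
  by move=> DD FD; rewrite {2}FD mulrA -(mulrA F) DD -mulrA -FD mulrA FF.
have adjF D : D^h = D -> F * D = D * F -> (F * D)^h = F * D.
  by move=> Dh FD; rewrite adjM// Dh Fh.
have FPh := adjF P Ph FP; have FPP := idem P PP FP.
have FQh := adjF Q compl_adj FQ; have FQQ := idem Q compl_idem FQ.
have posF : pos_part dot (F \o Cop P \o F) = F * P.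
  rewrite CopE; have -> : F \o C \o F = F * C * F by [].
  apply: (@pos_partE _ _ _ norm_inner (F * C * F) (F * P) (F * Q)).
  - exact: pos_idem.
  - exact: pos_idem.
  - by rewrite FC -mulrA FF -FC CE mulrBr.
  - by rewrite [in X in _ * X]FQ mulrA -(mulrA F) mulPQ mulr0 mul0r.
have PVF : PVplus dot P W = F * P.
  rewrite /PVplus kerF (proj_onE norm_inner Fh FF) posF CopE.
  rewrite (@inv_onE _ _ _ norm_inner (F * P) (F * P) (F * P)) ?FPP//.
  by apply: (@congr1 _ _ (@bop_fun _ _) (F * P * C)); rewrite -mulrA mulPC.
have PE : W * P * W^h + F * P = P.
  by rewrite WP FP -mulrA -mulrDr FE addrC subrK mulr1.
rewrite /PV PVF dagE dW.
by transitivity (bop_fun (W * P * W^h + F * P)); last by rewrite PE.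
Qed.

(** Used with [E = P] and [E = Q]. As [W] commutes with [E], the block of [U W] is [u w] with
    [u = E U E] positive and [w = E W] unitary on the range of [E]; its absolute value is [w^h u w],
    inverted there by [w^h rho w]. *)
Lemma block_polar_decomposition E U W rho : E^h = E -> E * E = E -> W * E = E * W ->
    W^h * W = 1 -> W * W^h = 1 -> pos U -> rho * E = E * rho -> rho^h = rho ->
    E * U * E * rho = E ->
  [/\ abs_op dot (E * (U * W) * E) = (E * W)^h * (E * U * E) * (E * W),
      abs_op dot (E * (U * W) * E)^h = E * U * E,
      (E * (U * W) * E) \o inv_on dot (range E) (abs_op dot (E * (U * W) * E)) = E * W,
      E * (U * W) * E = E * W * ((E * W)^h * (E * U * E) * (E * W)) &
      unitary_on dot E (E * W)].
Proof.
move=> Eh EE WE WW' WW posU rE rh uE.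
have [w wE] : exists w, w = E * W by eexists.
have [u uDef] : exists u, u = E * U * E by eexists.
rewrite -wE -uDef in uE *.
have posu : pos u by rewrite uDef -{1}Eh; exact: pos_congr.
have uh := pos_adj posu.
have uEE : u * E = u by rewrite uDef -mulrA EE.
have Eu : E * u = u by rewrite -Eh -uh -adjM// uEE.
have uEr := mulr_eqr uEE.
have wEE : w * E = w by rewrite wE -WE -mulrA EE.
have Ew : E * w = w by rewrite wE mulrA EE.
have whE : E * w^h = w^h by rewrite -{1}Eh -adjM// wEE.
have whE' : w^h * E = w^h by rewrite -{1}Eh -adjM// Ew.
have wwh : w * w^h = E by rewrite wE adjM// Eh mulrA -(mulrA E) WW mulr1 EE.
have whw : w^h * w = E by rewrite wE -WE adjM// Eh mulrA -(mulrA E) WW' mulr1 EE.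
have ru : rho * u = E by rewrite -{1}rh -uh -adjM// uE Eh.
have AE : E * (U * W) * E = u * w.
  by rewrite wE [RHS]mulrA uEE uDef !mulrA -(mulrA _ W) WE !mulrA.
have absE : abs_op dot (E * (U * W) * E) = w^h * u * w.
  rewrite AE; apply: abs_opE => //; first exact: pos_congr.
  by rewrite adjM// uh !mulrA -(mulrA (w^h * u)) wwh uEr.
split=> //.
- rewrite AE; apply: abs_opE => //.
  by rewrite adjK// adjM// uh mulrA -(mulrA u) wwh uEE.
- have invE : inv_on dot (range E) (abs_op dot (E * (U * W) * E)) = w^h * rho * w.
    rewrite absE; apply: inv_onE => //.
    + by rewrite !mulrA whE.
    + by rewrite -mulrA wEE.
    + rewrite !mulrA -(mulrA (w^h * rho)) wwh -(mulrA w^h) rE !mulrA whE'.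
      by rewrite -(mulrA w^h) ru whE' whw EE.
    + rewrite !mulrA -(mulrA (w^h * u)) wwh uEr -(mulrA w^h) uE.
      by rewrite whE' whw.
  rewrite invE; transitivity (bop_fun (E * (U * W) * E * (w^h * rho * w))) => //.
  by rewrite AE !mulrA -(mulrA u) wwh uEE uE Ew.
- by rewrite AE !mulrA wwh Eu.
- split; first by transitivity (bop_fun (E * w * E)); last by rewrite Ew wEE.
    by rewrite adjE//; transitivity (bop_fun (w^h * w)); last by rewrite whw.
  by rewrite adjE//; transitivity (bop_fun (w * w^h)); last by rewrite wwh.
Qed.

Lemma diagonalize V : bar V = V -> dagb V * V = 1 ->
  exists U W rho : bop K,
  [/\ [/\ UV dot P V = U, WV dot P V = W & V = U * W],
      [/\ pos U, U * dagb U = 1, dagb U * U = 1 & bar U = U],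
      [/\ W * P = P * W, dagb W * W = 1 & bar W = W],
      [/\ rho * P = P * rho, rho^h = rho, P * U * P * rho = P & Q * U * Q * rho = Q] &
      PV dot P U = PV dot P V /\ forall e, orthonormal_basis dot e -> hs e (P * V * Q) -> hs e (U - 1)].
Proof.
move=> Vb VV; have [p [PVp [pp posp] bp pV hsp]] := PV_spec Vb VV.
have [U [rho [[posU UdU dUU Ub] UPU UZE rhoP hsU]]] := conjugating_operator pp posp bp.
exists U, (dagb U * V), rho.
have UVE : UV dot P V = U by rewrite /UV /ZV PVp.
split.
- split; [exact: UVE|by rewrite /WV UVE dagE|by rewrite mulrA UdU mul1r].
- by split.
- split.
  + by rewrite -mulrA -pV -UPU !mulrA dUU mul1r.
  + by rewrite dagbM dagbK mulrA -(mulrA _ U) UdU mulr1.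
  + by rewrite barM bar_dagb Ub Vb.
- exact: rhoP.
- split; last by move=> e e_b V12; apply: (hsU e e_b); exact: hsp.
  (* The idempotent of [U] satisfies [p' U = U P]; since [U] is invertible, this forces
     [p' = U P U^d = p]. *)
  have [p' [PVp' _ _ p'U _]] := PV_spec Ub dUU.
  rewrite PVp PVp'; congr bop_fun.
  by rewrite -UPU -p'U -mulrA UdU mulr1.
Qed.

Lemma ker_dag0 V : V * dagb V = 1 -> ker (dag dot P V) = [set 0].
Proof.
move=> VV; rewrite dagE; apply/seteqP; split=> [f|f ->]; last exact: linear0.
rewrite /ker/= => Vf0.
by rewrite -[f]/((1 : bop K) f) -VV -[LHS]/(V (C (V^h (C f)))) Vf0 linear0.
Qed.

Lemma ind_eq0 (V : bop K) : ind dot P V = 0%E -> dagb V * V = 1 -> V * dagb V = 1.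
Proof.
move=> /eqP; rewrite oppe_eq0 => /eqP/dim_set_eq0; rewrite dagE => ker0 VV.
apply/esym/subr0_eq/bop_inj => f; apply: ker0.
rewrite /ker/= -[LHS]/((dagb V * (1 - V * dagb V)) f).
by rewrite mulrBr mulr1 mulrA VV mul1r subrr.
Qed.

Lemma S_P1_diagonalize (V : bop K) : S_P1 dot star P V ->
  [/\ V = UV dot P V \o WV dot P V :> (K -> K),
      S_HS dot star P (UV dot P V) /\ S_diag dot star P (WV dot P V),
      [/\ ind dot P (UV dot P V) = 0%E,
          ZV dot P (UV dot P V) = ZV dot P V &
          PV dot P (UV dot P V) = PV dot P V] &
      [/\ ind dot P (WV dot P V) = ind dot P V,
          ZV dot P (WV dot P V) = cst 0 &
          PV dot P (WV dot P V) = P]].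
Proof.
move=> [/S_gammaE[Vb VV] V12].
have [U [W [rho [[UE WE VE] [posU UdU dUU Ub] [WP WW Wb] _ [PVU hsU]]]]] := diagonalize Vb VV.
have {}V12 : exists2 e, orthonormal_basis dot e & hs e (P * V * Q).
  apply/(hilbert_schmidtE dot (P * V * Q)).
  by have := V12; rewrite /b12 P2E.
have PVW := PV_diag WW WP.
rewrite UE WE; split.
- by rewrite {1}VE.
- have [e e_b Ve] := V12; split; last first.
    split; first by apply/S_gammaE; split.
    exact: (congr1 (@bop_fun _ _) (esym WP)).
  split; first by apply/S_gammaE; split.
  by apply/(hilbert_schmidtE dot (U - 1)); exists e; last exact: hsU.
- split; [|by rewrite /ZV PVU|exact: PVU].
  by rewrite /ind (ker_dag0 UdU) dim_set0 oppe0.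
- split; [| |exact: PVW].
    rewrite /ind; congr (- _)%E.
    have dW : dagb W = dagb V * U by rewrite VE dagbM -mulrA dUU mulr1.
    rewrite -(dim_set_preimage (ker (dag dot P V)) UdU dUU) !dagE dW.
    by [].
  rewrite /ZV PVW; have -> : b21 P P = (0 : bop K).
    rewrite /b21 P2E -[LHS]/(bop_fun (Q * P * P)).
    by rewrite mulQP mul0r.
  by [].
Qed.

Lemma S_P1_ind0 (V : bop K) : S_P1 dot star P V -> ind dot P V = 0%E ->
  [/\ [/\ b11 P V = v11 dot P V \o abs_op dot (b11 P V),
          b22 P V = v22 dot P V \o abs_op dot (b22 P V),
          unitary_on dot P (v11 dot P V),
          unitary_on dot (P2 P) (v22 dot P V) &
          v22 dot P V = Defs.bar star (v11 dot P V)],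
      UV dot P V =
        block_op P
          (abs_op dot (adj dot (b11 P V)))
          (b12 P V \o adj dot (v22 dot P V))
          (b21 P V \o adj dot (v11 dot P V))
          (abs_op dot (adj dot (b22 P V))) &
      WV dot P V =
        block_op P (v11 dot P V) (cst 0) (cst 0) (v22 dot P V)].
Proof.
move=> [/S_gammaE[Vb VV] _] ind0; have VV' := ind_eq0 ind0 VV.
have [U [W [rho [[UE WE VE] [posU UdU dUU Ub] [WP WW Wb] [rP rh uP uQ] _]]]] := diagonalize Vb VV.
have WC := sgnb_comm WP; have WQ := compl_comm WP.
have dW : dagb W = W^h.
  by rewrite /dagb -{1}sgnb_adj -adjM// WC adjM// sgnb_adj mul_sgnb_sqr.
have WWd : W * dagb W = 1.
  have -> : W = dagb U * V by rewrite VE mulrA dUU mul1r.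
  by rewrite dagbM dagbK mulrA -(mulrA _ V) VV' mulr1 dUU.
rewrite dW in WW WWd.
have WhP : W^h * P = P * W^h by rewrite -{1}Ph -adjM// -WP adjM// Ph.
have [abs1 abs1' v1 pol1 un1] := block_polar_decomposition Ph PP WP WW WWd posU rP rh uP.
have [abs2 abs2' v2 pol2 un2] :=
  block_polar_decomposition compl_adj compl_idem WQ WW WWd posU (compl_comm rP) rh uQ.
rewrite -VE in abs1 abs1' v1 pol1 abs2 abs2' v2 pol2.
have b11E : b11 P V = P * V * P by [].
have b22E : b22 P V = Q * V * Q by rewrite /b22 P2E.
have v11E : v11 dot P V = P * W by rewrite /v11 b11E.
have v22E : v22 dot P V = Q * W by rewrite /v22 b22E P2E.
rewrite v11E v22E b11E b22E UE WE !adjE// P2E abs1 abs2 abs1' abs2'.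
split.
- split; [by rewrite {1}pol1|by rewrite {1}pol2|exact: un1|exact: un2|].
  by rewrite -[RHS]/(bop_fun (bar (P * W))) barM bar_proj Wb.
- rewrite /block_op /b12 /b21 /b22 P2E.
  have {1}-> : U = P * (P * U * P) * P + P * (P * V * Q * (Q * W)^h) * Q +
      (Q * (Q * V * P * (P * W)^h) * P + Q * (Q * U * Q) * Q).
    (* [W] is unitary and commutes with [P], so [V W^h = U] and the factor [W^h] removes the unitary
       part from each off-diagonal block. *)
    have e1 : Q * V * P * (P * W)^h = Q * U * P.
      rewrite adjM// Ph VE WhP !mulrA PPr -(mulrA _ W) WP !mulrA -(mulrA _ W) WWd.
      exact: mulr1.
    have e2 : P * V * Q * (Q * W)^h = P * U * Q.
      rewrite adjM// compl_adj VE (compl_comm WhP) !mulrA QQr -(mulrA _ W) WQ !mulrA.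
      rewrite -(mulrA _ W) WWd; exact: mulr1.
    rewrite e1 e2 !mulrA PP compl_idem !PPr !QQr QE; bop_ring norm_inner.
  by [].
- rewrite /block_op /b12 /b21 /b22 P2E.
  have {1}-> : W = P * (P * W) * P + P * 0 * Q + (Q * 0 * P + Q * (Q * W) * Q).
    rewrite !(mulr0, mul0r) addr0 add0r !mulrA PP compl_idem -!(mulrA _ W) WP WQ.
    by rewrite !mulrA PP compl_idem -mulrDl addPQ mul1r.
  by [].
Qed.

(** Here [p = P], so [U] commutes with [P] and [dagb U = U]. Then [U] is a positive root of 1, hence
    equal to 1. *)
Lemma S_diag_id (V : bop K) : S_diag dot star P V -> UV dot P V = idfun /\ WV dot P V = V.
Proof.
move=> [/S_gammaE[Vb VV] PV_VP].
have {PV_VP}VP : V * P = P * V by apply: bop_fun_inj.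
have PVV := PV_diag VV VP.
have posPC : pos (P * C) by rewrite mulPC; exact: pos_idem.
have [U [rho [[posU UdU dUU _] UPU UZE _ _]]] := conjugating_operator PP posPC barP.
have UVE : UV dot P V = U by rewrite /UV /ZV PVV.
have UP : U * P = P * U by rewrite -{2}UPU -mulrA dUU mulr1.
have U1 : U = 1.
  have dU : dagb U = U by rewrite /dagb (pos_adj posU) -(sgnb_comm UP) mul_sgnb_sqr.
  rewrite dU in UdU.
  apply: (sqrt_unique norm_inner posU (pos1 norm_inner) UdU); first exact: mulr1.
  by rewrite mulr1 mul1r.
split; first by rewrite UVE U1.
rewrite /WV UVE U1 dagE; have -> : dagb 1 = 1 by rewrite /dagb adj1// mulr1 sgnb_sqr.
by [].
Qed.

End IndefiniteSplitting.

Theorem proposition4p4 (R : realType) (K : completeNormedModType R[i])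
    (dot : {dot K for Num.conj}) (star P1 : K -> K)
    (norm_inner : forall f : K, `|f| ^+ 2 = inner dot f f)
    (sepK : separable_space K)
    (infK : dim_set [set: K] = +oo%E)
    (starP : conjugation dot star)
    (P1_proj : orth_projection dot P1)
    (P2_bar : P2 P1 = bar star P1) :
  [/\ forall V : K -> K, S_P1 dot star P1 V ->
        [/\ V = UV dot P1 V \o WV dot P1 V,
            S_HS dot star P1 (UV dot P1 V) /\
            S_diag dot star P1 (WV dot P1 V),
            [/\ ind dot P1 (UV dot P1 V) = 0%E,
                ZV dot P1 (UV dot P1 V) = ZV dot P1 V &
                PV dot P1 (UV dot P1 V) = PV dot P1 V] &
            [/\ ind dot P1 (WV dot P1 V) = ind dot P1 V,
                ZV dot P1 (WV dot P1 V) = cst 0 &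
                PV dot P1 (WV dot P1 V) = P1]],
      forall V : K -> K, S_P1 dot star P1 V -> ind dot P1 V = 0%E ->
        [/\ [/\ b11 P1 V = v11 dot P1 V \o abs_op dot (b11 P1 V),
                b22 P1 V = v22 dot P1 V \o abs_op dot (b22 P1 V),
                unitary_on dot P1 (v11 dot P1 V),
                unitary_on dot (P2 P1) (v22 dot P1 V) &
                v22 dot P1 V = bar star (v11 dot P1 V)],
            UV dot P1 V =
              block_op P1
                (abs_op dot (adj dot (b11 P1 V)))
                (b12 P1 V \o adj dot (v22 dot P1 V))
                (b21 P1 V \o adj dot (v11 dot P1 V))
                (abs_op dot (adj dot (b22 P1 V))) &
            WV dot P1 V =
              block_op P1 (v11 dot P1 V) (cst 0) (cst 0) (v22 dot P1 V)] &
      forall V : K -> K, S_diag dot star P1 V ->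
        UV dot P1 V = idfun /\ WV dot P1 V = V].
Proof.
have [[bP1 _] _] := P1_proj.
(* Boundedness, part of being an orthogonal projection, turns the function [P1] into an element of
   the operator ring. *)
have [P PE] : exists P : bop K, P1 = P by exists (Bop bP1).
subst P1.
have [Ph PP] := (orth_projectionE norm_inner P).1 P1_proj.
have barP : barb norm_inner starP P = 1 - P.
  by apply: bop_fun_inj; exact: esym P2_bar.
split=> V SV.
- have [[bV _ _] _] := SV.
  exact: (S_P1_diagonalize Ph PP barP erefl erefl (V := Bop bV)).
- have [[bV _ _] _] := SV.
  exact: (S_P1_ind0 Ph PP barP erefl erefl (V := Bop bV)).
- have [[bV _ _] _] := SV.
  exact: (S_diag_id Ph PP barP erefl erefl (V := Bop bV)).
Qed.
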